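(* Let $A$ be a finite dimensional algebra over an algebraically closed field. If $f:M\rightarrow N$ is an irreducible monomorphism in a $\pi$-component of $\Gamma_A$ such that $\mathrm{Coker} f$ lies in a regular component of $\Gamma_A$, then $\mathrm{Coker} f$ is simple regular.
   Context: All algebras are assumed basic. $\mathrm{mod}A$ is the category of finitely generated left $A$-modules, $\mathrm{ind}A$ is the full subcategory consisting of one representative of each isomorphism class of indecomposable modules, and $\Gamma_A$ is the Auslander-Reiten quiver of $A$. Postprojective partition (Auslander-Smalø): write $\mathbb{N}_\infty=\mathbb{N}\cup\{\infty\}$ with $0\in\mathbb{N}$. A postprojective partition of $A$ is a partition $\{\mathbf{P}_i\}_{i\in\mathbb{N}_\infty}$ of $\mathrm{ind}A$ such that (a) $\mathrm{ind}A$ is the disjoint union of the subcategories $\mathbf{P}_i$, $i\in\mathbb{N}_\infty$; (b) for each $j<\infty$, $\mathbf{P}_j$ is a finite minimal cover of $\bigcup_{j\le i\le\infty}\mathbf{P}_i$. Here a subcategory $\mathcal{D}\subseteq\mathcal{C}$ is a cover of $\mathcal{C}$ if every module in $\mathcal{C}$ is an epimorphic image of a module in $\mathrm{add}\,\mathcal{D}$, and it is minimal if no proper subcategory of $\mathcal{D}$ is a cover of $\mathcal{C}$. Every Artin algebra has a unique such partition. Modules in $\mathrm{add}\,\mathbf{P}$, where $\mathbf{P}=\bigcup_{0\le i<\infty}\mathbf{P}_i$, are called postprojective. A $\pi$-component of $\Gamma_A$ is a connected component containing only postprojective modules; a morphism $f:M\to N$ is in the component if $M$ and $N$ are indecomposable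 modules lying in it. A regular component of $\Gamma_A$ is a connected component containing neither projective nor injective modules. A regular module is a direct sum of indecomposable modules lying in regular components; an indecomposable regular module is simple regular if it has no nontrivial (nonzero proper) regular submodule. *)

(* Defs.v *)
From Stdlib Require List Relation_Operators.
From HB Require Import structures.
From mathcomp Require Import all_boot all_order all_algebra all_field.

Set Implicit Arguments.
Unset Strict Implicit.
Unset Printing Implicit Defensive.

Import GRing.Theory.
Local Open Scope ring_scope.

Section ModuleCategory.
Variables (K : fieldType) (A : falgType K).
Implicit Types (M N Q U X Y : lmodType A) (C D : lmodType A -> Prop).

Definition surjective M N (f : M -> N) : Prop := forall y, exists x, f x = y.

Definition isomorphic M N : Prop := exists f : {linear M -> N}, bijective f.

Definition nonzero_module M : Prop := exists x : M, x <> 0.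

(* The modules satisfying [fingen] are the objects of mod A.  A morphism of
   A-modules is a [{linear M -> N}]; it is automatically K-linear for the
   K-structure that M and N inherit from A. *)
Definition fingen M : Prop :=
  exists s : seq M, forall x, exists a : nat -> A,
    x = \sum_(i < size s) a i *: s`_i.

(* The direct sum of a finite list of modules; ['rV[A]_0] is the zero module. *)
Definition direct_sum (s : seq (lmodType A)) : lmodType A :=
  foldr (fun X Y : lmodType A => (X * Y)%type : lmodType A)
        ('rV[A]_0 : lmodType A) s.

Definition indecomposable M : Prop :=
  [/\ fingen M, nonzero_module M &
      forall X Y, isomorphic M (X * Y)%type ->
        ~ (nonzero_module X /\ nonzero_module Y)].

Definition split_mono M N (f : {linear M -> N}) : Prop :=
  exists r : {linear N -> M}, forall x, r (f x) = x.

Definition split_epi M N (f : {linear M -> N}) : Prop :=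
  exists s : {linear N -> M}, forall y, f (s y) = y.

(* Projectivity and injectivity are those of the category mod A. *)
Definition projective_module M : Prop :=
  fingen M /\
  forall X Y, fingen X -> fingen Y ->
  forall (p : {linear X -> Y}) (h : {linear M -> Y}), surjective p ->
    exists l : {linear M -> X}, forall x, p (l x) = h x.

Definition injective_module M : Prop :=
  fingen M /\
  forall X Y, fingen X -> fingen Y ->
  forall (i : {linear X -> Y}) (h : {linear X -> M}), injective i ->
    exists l : {linear Y -> M}, forall x, l (i x) = h x.

(* [q : N -> Q] exhibits Q as Coker f, i.e. Q = N / Im f with projection q. *)
Definition is_cokernel M N Q (f : {linear M -> N}) (q : {linear N -> Q}) :
  Prop :=
  surjective q /\ (forall y, q y = 0 <-> exists x, f x = y).

Definition basic_algebra : Prop :=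
  exists s : seq (lmodType A),
    [/\ isomorphic (A^o : lmodType A) (direct_sum s),
        List.Forall indecomposable s &
        List.ForallOrdPairs (fun X Y => ~ isomorphic X Y) s].

(* A full subcategory of ind A is a set of isomorphism classes of
   indecomposable modules; it is encoded by the corresponding
   isomorphism-invariant predicate on all A-modules. *)
Definition ind_subcategory D : Prop :=
  (forall X, D X -> indecomposable X) /\
  (forall X Y, isomorphic X Y -> D X -> D Y).

Definition add D M : Prop :=
  exists (s : seq (lmodType A)) (M' : lmodType A),
    List.Forall D s /\ isomorphic (direct_sum s) (M * M')%type.

Definition cover D C : Prop :=
  (forall X, D X -> C X) /\
  forall M, C M -> exists X, add D X /\
    exists p : {linear X -> M}, surjective p.

Definition minimal_cover D C : Prop :=
  cover D C /\
  forall D', ind_subcategory D' -> (forall X, D' X -> D X) -> cover D' C ->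
    forall X, D X -> D' X.

Definition finite_subcategory D : Prop :=
  exists s : seq (lmodType A), forall X, D X -> List.Exists (isomorphic X) s.

(* The index set is N together with infinity: [Some i] is the natural number
   i and [None] is infinity. *)
Definition geq_index (j : nat) (i : option nat) : Prop :=
  if i is Some k then (j <= k)%N else True.

Definition postprojective_partition (P : option nat -> lmodType A -> Prop) :
  Prop :=
  [/\ forall i, ind_subcategory (P i),
      forall X, indecomposable X -> exists! i, P i X &
      forall j : nat,
        finite_subcategory (P (Some j)) /\
        minimal_cover (P (Some j)) (fun X => exists i, geq_index j i /\ P i X)].

Definition postprojective_module (P : option nat -> lmodType A -> Prop) M :
  Prop :=
  add (fun X => exists i : nat, P (Some i) X) M.

Definition irreducible_morphism M N (f : {linear M -> N}) : Prop :=
  [/\ ~ split_mono f, ~ split_epi f &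
      forall X, fingen X ->
      forall (g : {linear M -> X}) (h : {linear X -> N}),
        (forall x, f x = h (g x)) -> split_mono g \/ split_epi h].

(* The Auslander-Reiten quiver has the isomorphism classes of indecomposable
   modules as vertices, hence isomorphic modules are also linked.  Valuations
   and multiplicities of arrows are irrelevant to connectedness. *)
Definition ar_link X Y : Prop :=
  [/\ indecomposable X, indecomposable Y &
      isomorphic X Y \/
      exists f : {linear X -> Y}, irreducible_morphism f].

Definition ar_component C : Prop :=
  exists X, indecomposable X /\
    forall Y, C Y <-> Relation_Operators.clos_refl_sym_trans _ ar_link X Y.

(* The postprojective partition of A exists and is unique (Auslander-Smalo),
   so P below is the postprojective partition. *)
Definition pi_component C : Prop :=
  ar_component C /\
  exists P, postprojective_partition P /\
    forall X, C X -> postprojective_module P X.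

Definition regular_component C : Prop :=
  ar_component C /\
  forall X, C X -> ~ projective_module X /\ ~ injective_module X.

Definition in_regular_component M : Prop :=
  exists C, regular_component C /\ C M.

Definition regular_module M : Prop :=
  exists s : seq (lmodType A),
    List.Forall in_regular_component s /\ isomorphic M (direct_sum s).

(* Submodules of M are given by injective linear maps U -> M. *)
Definition simple_regular M : Prop :=
  [/\ indecomposable M, regular_module M &
      forall U (i : {linear U -> M}), injective i -> regular_module U ->
        ~ (nonzero_module U /\ ~ surjective i)].

End ModuleCategory.

Arguments basic_algebra {K} A.

(* Main.v *)
(* Write [P_i] for the i-th part of the postprojective partition.  Let [X] be in
   [P_n].  Minimality of [P_n] implies that the non-isomorphisms to [X] from
   indecomposables of index at least [n] have images in one proper submodule [T]
   of [X].  Adding to the inclusion of [T] an approximation of [X] by the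
   finitely many modules of index less than [n] gives a right almost split map to
   [X]; hence nonprojective modules of finite index receive irreducible maps from
   modules of smaller index, and modules in regular components have index
   infinity.

   Let [X] lie in a pi-component.  Iterating almost split maps, the Harada-Sai
   lemma shows that any map from a module of index infinity to [X] factors, for
   each [m], through modules of the component of index at least [m].  The traces
   of these modules in [X] decrease to a submodule all of whose indecomposable
   summands have index infinity; as the inclusion of such a summand factors
   through modules of the component with image in the trace, the summand would
   itself lie in the component.  So the trace is eventually zero, and there are no
   nonzero maps from modules of index infinity to [X].

   Finally, as [f] is irreducible, the inclusion of a proper submodule of its
   cokernel lifts to [N]; if the submodule is regular the lift is zero. *)

From HB Require Import structures.
Require Import Defs.
From mathcomp Require Import all_boot all_order all_algebra all_field.
From mathcomp Require Import boolp.

Set Implicit Arguments.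
Unset Strict Implicit.
Unset Printing Implicit Defensive.

Import GRing.Theory.
Local Open Scope ring_scope.

(** * Submodules *)

Section Submodule.
Variables (R : nzRingType) (M : lmodType R) (S : M -> Prop).

Definition submodule_pred : {pred M} := fun x => `[< S x >].

Definition is_submodule : Prop :=
  S 0 /\ forall a x y, S x -> S y -> S (a *: x + y).

Record submodule (HS : is_submodule) := Submodule {
  submodule_val : M;
  _ : submodule_val \in submodule_pred }.

Hypothesis HS : is_submodule.

Lemma submodule_closed : submod_closed submodule_pred.
Proof.
split; first by apply/asboolP; case: HS.
by move=> a x y /asboolP Sx /asboolP Sy; apply/asboolP; case: HS => _; apply.
Qed.

HB.instance Definition _ :=
  GRing.isSubmodClosed.Build R M submodule_pred submodule_closed.

HB.instance Definition _ := [isSub for @submodule_val HS].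
HB.instance Definition _ := [Choice of submodule HS by <:].
HB.instance Definition _ := [SubChoice_isSubLmodule of submodule HS by <:].

(* Opaque, so that [/=] does not unfold the inclusion. *)
Fact incl_exists : {i : {linear submodule HS -> M} |
  injective i /\ forall x, S x <-> exists u, i u = x}.
Proof.
exists \val; split; first exact: val_inj.
move=> x; split=> [/asboolP Sx|[[y Sy] <-]]; last exact/asboolP.
by exists (Submodule HS Sx).
Qed.

Definition incl : {linear submodule HS -> M} := sval incl_exists.

Lemma incl_inj : injective incl.
Proof. by have [] := svalP incl_exists. Qed.

Lemma inclP x : S x <-> exists u, incl u = x.
Proof. by have [] := svalP incl_exists. Qed.

End Submodule.

(** * Dimension over the base field *)

Section Dimension.
Variables (K : fieldType) (A : falgType K).
Implicit Types M N X Y Z U V W : lmodType A.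

(** A scalar of [K] acts through its image in [A], since the modules carry no separate
    [K]-structure. *)
Definition lincomb M n (b : 'I_n -> M) (c : 'rV[K]_n) : M :=
  \sum_i (c 0 i)%:A *: b i.

Lemma lincombD M n (b : 'I_n -> M) c d :
  lincomb b (c + d) = lincomb b c + lincomb b d.
Proof.
rewrite /lincomb -big_split; apply: eq_bigr => i _ /=.
by rewrite mxE scalerDl scalerDl.
Qed.

Lemma lincombZ M n (b : 'I_n -> M) (k : K) c :
  lincomb b (k *: c) = k%:A *: lincomb b c.
Proof.
rewrite /lincomb scaler_sumr; apply: eq_bigr => i _ /=.
by rewrite mxE scalerA -scalerAl mul1r scalerA.
Qed.

Lemma lincombB M n (b : 'I_n -> M) c d :
  lincomb b (c - d) = lincomb b c - lincomb b d.
Proof. by rewrite -[- d]scaleN1r lincombD lincombZ !scaleN1r. Qed.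

Lemma lincomb0 M n (b : 'I_n -> M) : lincomb b 0 = 0.
Proof. by rewrite -[0](subrr 0) lincombB subrr. Qed.

Lemma lincomb_mulmx M m n (b : 'I_n -> M) (u : 'rV_m) (D : 'M_(m, n)) :
  lincomb b (u *m D) = lincomb (fun i => lincomb b (row i D)) u.
Proof.
rewrite mulmx_sum_row (big_morph _ (lincombD b) (lincomb0 b)).
by apply: eq_bigr => i _; rewrite lincombZ.
Qed.

Lemma lincomb_map M N (f : {linear M -> N}) n (b : 'I_n -> M) c :
  lincomb (f \o b) c = f (lincomb b c).
Proof.
by rewrite /lincomb linear_sum; apply: eq_bigr => i _ /=; rewrite linearZ.
Qed.

Definition spanning M n (b : 'I_n -> M) : Prop :=
  forall x, exists c, x = lincomb b c.

Definition spanned M n : Prop := exists b : 'I_n -> M, spanning b.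

Lemma spanned_fintype M (I : finType) (b : I -> M) :
  (forall x, exists c : I -> K, x = \sum_i (c i)%:A *: b i) ->
  spanned M #|I|.
Proof.
move=> bP; exists (b \o enum_val) => x; have [c ->] := bP x.
exists (\row_i c (enum_val i)); rewrite /lincomb.
rewrite (big_enum_val (fun i => (c i)%:A *: b i)) /=.
by apply: eq_bigr => i _; rewrite mxE.
Qed.

(** Exchange: a vector with nonzero coefficient in a relation is a combination of the others. *)
Lemma spanned_pred M n (b : 'I_n -> M) (c : 'rV_n) :
  spanning b -> lincomb b c = 0 -> c != 0 -> spanned M n.-1.
Proof.
move=> bP bc0 /rV0Pn[i ci]; exists (fun j => b (lift i j)) => x.
have [d ->] := bP x; pose e := d - (d 0 i / c 0 i) *: c.
have -> : lincomb b d = lincomb b e.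
  by rewrite lincombB lincombZ bc0 scaler0 subr0.
exists (\row_j e 0 (lift i j)); rewrite /lincomb (bigD1_ord i) //= !mxE.
rewrite mulfVK // subrr scale0r scale0r add0r.
by apply: eq_bigr => j _; rewrite !mxE.
Qed.

Lemma fingen_spanned M : fingen M -> exists n, spanned M n.
Proof.
case=> s sP; pose d := \dim {:A}.
exists #|('I_(size s) * 'I_d)%type : finType|.
apply: (@spanned_fintype _ ('I_(size s) * 'I_d)%type
         (fun ij => (vbasis {:A})`_ij.2 *: s`_ij.1)) => x.
have [a ->] := sP x.
exists (fun ij : 'I_(size s) * 'I_d => coord (vbasis {:A}) ij.2 (a ij.1)).
rewrite -(pair_bigA _ (fun (i : 'I_(size s)) (j : 'I_d) =>
  (coord (vbasis {:A}) j (a i))%:A *: ((vbasis {:A})`_j *: s`_i))) /=.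
apply: eq_bigr => i _; rewrite {1}(coord_vbasis (memvf (a i))) scaler_suml.
by apply: eq_bigr => j _; rewrite scalerA -scalerAl mul1r.
Qed.

Lemma spanned_fingen M n : spanned M n -> fingen M.
Proof.
case=> b bP; exists [seq b i | i <- enum 'I_n] => x; have [c ->] := bP x.
pose a i : A := if insub i is Some j then (c 0 j)%:A else 0; exists a.
rewrite -(big_mkord xpredT (fun i => a i *: [seq b i | i <- enum 'I_n]`_i)).
rewrite size_map size_enum_ord big_mkord; apply: eq_bigr => i _.
by rewrite /a valK (nth_map i) ?size_enum_ord // nth_ord_enum.
Qed.

(** The default [0] occurs only for modules that are not finitely generated. *)
Definition kdim M : nat :=
  if pselect (exists n, `[< spanned M n >]) is left e then ex_minn e else 0.

Lemma kdimP M : fingen M -> spanned M (kdim M).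
Proof.
move=> /fingen_spanned[n Mn]; rewrite /kdim; case: pselect => [e|[]].
  by case: ex_minnP => m /asboolP.
by exists n; apply/asboolP.
Qed.

Lemma kdim_min M n : spanned M n -> (kdim M <= n)%N.
Proof.
move=> Mn; rewrite /kdim; case: pselect => // e.
by case: ex_minnP => m _; apply; apply/asboolP.
Qed.

Lemma kdim_free M (b : 'I_(kdim M) -> M) c :
  spanning b -> lincomb b c = 0 -> c = 0.
Proof.
move=> bP bc; apply: contrapT => /eqP c0.
have /kdim_min := spanned_pred bP bc c0.
by case/rV0Pn: c0 => -[i +] _; case: (kdim M) => // m _; rewrite ltnn.
Qed.

Lemma coords M : fingen M ->
  exists (b : 'I_(kdim M) -> M) (phi : M -> 'rV[K]_(kdim M)),
    cancel phi (lincomb b) /\ cancel (lincomb b) phi.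
Proof.
move=> /kdimP[b bP]; have [phi phiP] := choice bP.
exists b, phi; split=> [x|c]; first by rewrite -phiP.
apply/eqP; rewrite -subr_eq0; apply/eqP; apply: (kdim_free bP).
by rewrite lincombB -phiP subrr.
Qed.

(** [D] is a maximal independent family of vectors of [S]. As [S] need not be a subspace, this also
    serves for sets of non-isomorphisms. *)
Lemma set_basis n (S : 'rV[K]_n -> Prop) :
  exists m (D : 'M[K]_(m, n)),
    [/\ row_free D, forall i, S (row i D) & forall v, S v -> (v <= D)%MS].
Proof.
pose P m := `[< exists D : 'M[K]_(m, n), row_free D /\ forall i, S (row i D) >].
have P0 : exists m, P m.
  exists 0%N; apply/asboolP; exists 0; split=> [|[]//].
  by rewrite /row_free mxrank0.
have Pn m : P m -> (m <= n)%N.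
  by move=> /asboolP[D [/eqP Dm _]]; rewrite -Dm rank_leq_col.
case: (ex_maxnP P0 Pn) => m /asboolP[D [Dfree DS]] mmax.
exists m, D; split=> // v Sv; apply: contrapT => vD.
suff /mmax : P m.+1 by rewrite ltnn.
apply/asboolP; rewrite -[m.+1]add1n; exists (col_mx v D); split; last first.
  move=> i; case: (split_ordP i) => j ->; last by rewrite rowKd.
  by rewrite rowKu; have -> : row j v = v by apply/rowP => k; rewrite mxE ord1.
apply: inj_row_free => w; rewrite -[w]hsubmxK mul_row_col => vD0.
have w0 : lsubmx w = 0.
  apply: contrapT => w0; apply: vD; move: w0 vD0.
  rewrite [lsubmx w]mx11_scalar; move: (lsubmx w 0 0) => k k0.
  have {}k0 : k != 0 by apply: contra_notN k0 => /eqP ->; rewrite raddf0.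
  rewrite mul_scalar_mx => /eqP; rewrite addr_eq0 => /eqP kv.
  by rewrite -(eqmx_scale _ k0) kv -mulNmx submxMl.
move: vD0; rewrite w0 mul0mx add0r => /eqP.
by rewrite mulmx_free_eq0 // => /eqP ->; rewrite row_mx0.
Qed.

(** A basis chosen among the coordinate vectors of the image pulls back to a spanning family of [M];
    if it has full rank, [f] is onto. *)
Lemma kdim_inj M N (f : {linear M -> N}) : injective f -> fingen N ->
  [/\ fingen M, (kdim M <= kdim N)%N &
      (kdim N <= kdim M)%N -> bijective f].
Proof.
move=> finj Nfg; have [b [phi [phiK bK]]] := coords Nfg.
have [m [D [Dfree DS DP]]] := set_basis (fun v => exists x, phi (f x) = v).
have [e eP] := choice DS.
have eS : spanning e.
  move=> x; have /submxP[u uD] : (phi (f x) <= D)%MS by apply: DP; exists x.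
  exists u; apply: finj; rewrite -[LHS]phiK uD lincomb_mulmx -lincomb_map.
  by apply: eq_bigr => i _; rewrite -eP phiK.
have Mm : spanned M m by exists e.
have mN : (m <= kdim N)%N by rewrite -[m in (m <= _)%N](eqP Dfree) rank_leq_col.
split; [exact: spanned_fingen Mm | exact: leq_trans (kdim_min Mm) mN |].
move=> /leq_trans/(_ (kdim_min Mm)) Nm.
have Dfull : row_full D by rewrite /row_full (eqP Dfree) eqn_leq mN.
have fsurj y : exists x, f x = y.
  have /submxP[u uD] := submx_full (phi y) Dfull.
  exists (lincomb e u); rewrite -lincomb_map -[RHS]phiK uD lincomb_mulmx.
  by apply: eq_bigr => i _; rewrite -eP phiK.
by have [g gP] := choice fsurj; exists g => // x; apply: finj; rewrite gP.
Qed.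

(** The image of a minimal spanning family spans [N]; when the dimensions agree, a nontrivial
    relation among these images would give a family shorter than [kdim N]. *)
Lemma kdim_surj M N (f : {linear M -> N}) : surjective f -> fingen M ->
  [/\ fingen N, (kdim N <= kdim M)%N &
      (kdim M <= kdim N)%N -> bijective f].
Proof.
move=> fsurj Mfg; have [b bP] := kdimP Mfg.
have fbP : spanning (f \o b).
  by move=> y; have [x <-] := fsurj y; have [c ->] := bP x;
     exists c; rewrite lincomb_map.
have NM : spanned N (kdim M) by exists (f \o b).
split; [exact: spanned_fingen NM | exact: kdim_min |] => MN.
have f0 x : f x = 0 -> x = 0.
  have [c ->] := bP x; rewrite -lincomb_map => fc.
  have [->|c0] := eqVneq c 0; first by rewrite lincomb0.
  have M0 : (0 < kdim M)%N by case/rV0Pn: c0 => -[i +] _; case: (kdim M).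
  have /kdim_min := spanned_pred fbP fc c0.
  by rewrite -ltnS prednK // ltnNge MN.
have [g gP] := choice fsurj.
exists g => // x; apply/eqP; rewrite -subr_eq0; apply/eqP/f0.
by rewrite linearB gP subrr.
Qed.

(** Maps are compared through their matrices. The spanning maps lie in [S] itself, so
    non-isomorphisms are spanned by non-isomorphisms. *)
Lemma hom_basis Y X (S : {linear Y -> X} -> Prop) : fingen Y -> fingen X ->
  exists m (r : 'I_m -> {linear Y -> X}), (forall i, S (r i)) /\
    forall g, S g -> exists c : 'rV_m, forall y, g y = lincomb (r^~ y) c.
Proof.
move=> Yfg Xfg; have [b [phi [phiK bK]]] := coords Xfg.
have [d dP] := kdimP Yfg.
pose mat (g : {linear Y -> X}) := mxvec (\matrix_i phi (g (d i))).
have matE (g : {linear Y -> X}) i : g (d i) = lincomb b (row i (vec_mx (mat g))).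
  by rewrite mxvecK rowK phiK.
have [m [D [_ DS DP]]] := set_basis (fun v => exists g, S g /\ mat g = v).
have [r rP] := choice DS.
exists m, r; split=> [i|g Sg]; first by case: (rP i).
have /submxP[u uD] : (mat g <= D)%MS by apply: DP; exists g.
exists u => y; have [c ->] := dP y.
have gE i : g (d i) = lincomb (r^~ (d i)) u.
  rewrite matE uD mulmx_sum_row !linear_sum.
  rewrite (big_morph _ (lincombD b) (lincomb0 b)).
  apply: eq_bigr => j _; rewrite !linearZ lincombZ.
  by have [_ <-] := rP j; rewrite -matE.
rewrite -lincomb_map /lincomb.
under eq_bigr do rewrite /= gE /lincomb scaler_sumr.
rewrite exchange_big; apply: eq_bigr => j _.
rewrite -/(lincomb d c) -lincomb_map /lincomb scaler_sumr.
by apply: eq_bigr => i _; rewrite /= !scalerA -!scalerAl !mul1r !scalerA mulrC.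
Qed.

End Dimension.

(** * Indecomposable modules and the Harada-Sai lemma *)

Section HaradaSai.
Variables (K : fieldType) (A : falgType K).
Implicit Types M N X Y Z U V W : lmodType A.

Definition lin_of M N (f : M -> N) (lin_f : linear f) : {linear M -> N} :=
  HB.pack f (GRing.isLinear.Build A M N *:%R f lin_f).

Lemma inj_surj_bij M N (f : M -> N) : injective f -> surjective f -> bijective f.
Proof.
by move=> finj /choice[g gP]; exists g => // x; apply: finj; rewrite gP.
Qed.

Lemma bij_surj M N (f : M -> N) : bijective f -> surjective f.
Proof. by case=> g _ gK y; exists (g y). Qed.

Lemma ker0_inj M N (f : {linear M -> N}) :
  (forall x, f x = 0 -> x = 0) -> injective f.
Proof.
move=> f0 x y fxy; apply/eqP; rewrite -subr_eq0; apply/eqP/f0.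
by rewrite linearB fxy subrr.
Qed.

Lemma lift_inj U X Z (i : {linear U -> X}) (h : {linear Z -> X}) :
  injective i -> (forall z, exists u, i u = h z) ->
  exists h' : {linear Z -> U}, forall z, i (h' z) = h z.
Proof.
move=> iinj /choice[g gP].
have lin_g : linear g by move=> a x y; apply: iinj; rewrite !linearP !gP linearP.
by exists (lin_of lin_g).
Qed.

Lemma bij_inv M N (f : {linear M -> N}) : bijective f ->
  exists g : {linear N -> M}, cancel f g /\ cancel g f.
Proof.
move=> fbij; have finj := bij_inj fbij.
have [g gP] := @lift_inj M N N f idfun finj (bij_surj fbij).
by exists g; split=> // x; apply: finj; rewrite gP.
Qed.

Lemma iso_refl M : isomorphic M M.
Proof. by exists idfun; exists idfun. Qed.

Lemma iso_sym M N : isomorphic M N -> isomorphic N M.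
Proof. by case=> f /bij_inv[g [fK gK]]; exists g; exists f. Qed.

Lemma iso_trans M N X : isomorphic M N -> isomorphic N X -> isomorphic M X.
Proof. by case=> f fb [g gb]; exists (g \o f); apply: bij_comp. Qed.

Lemma iso_fingen M N : isomorphic M N -> fingen M -> fingen N.
Proof. by case=> f /bij_surj fs Mfg; have [] := kdim_surj fs Mfg. Qed.

Lemma iso_kdim M N : isomorphic M N -> fingen M -> kdim M = kdim N.
Proof.
move=> MN Mfg; have Nfg := iso_fingen MN Mfg; case: (MN) => f fb.
have [_ NM _] := kdim_surj (bij_surj fb) Mfg.
have [_ {}MN _] := kdim_inj (bij_inj fb) Nfg.
by apply/eqP; rewrite eqn_leq MN.
Qed.

Lemma iso_nonzero M N : isomorphic M N -> nonzero_module M -> nonzero_module N.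
Proof.
case=> f /bij_inj finj [x x0]; exists (f x) => fx0; apply: x0; apply: finj.
by rewrite fx0 linear0.
Qed.

Lemma iso_indecomposable M N :
  isomorphic M N -> indecomposable M -> indecomposable N.
Proof.
move=> MN [Mfg M0 Mind]; split; first exact: iso_fingen MN Mfg.
  exact: iso_nonzero MN M0.
by move=> X Y NXY; apply: Mind; apply: iso_trans MN NXY.
Qed.

(** * Images, kernels and ranks *)

Lemma image_submodule M N (f : {linear M -> N}) :
  is_submodule (fun y => exists x, f x = y).
Proof.
split; first by exists 0; rewrite linear0.
by move=> a _ _ [x <-] [y <-]; exists (a *: x + y); rewrite linearP.
Qed.

Lemma ker_submodule M N (f : {linear M -> N}) : is_submodule (fun x => f x = 0).
Proof.
split=> [|a x y fx fy]; first exact: linear0.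
by rewrite linearP fx fy scaler0 addr0.
Qed.

Definition im_module M N (f : {linear M -> N}) := submodule (image_submodule f).

Lemma im_incl M N (f : {linear M -> N}) (u : im_module f) :
  exists x, f x = incl (image_submodule f) u.
Proof. by apply/(inclP (image_submodule f)); exists u. Qed.

Lemma incl_im M N (f : {linear M -> N}) x :
  exists u, incl (image_submodule f) u = f x.
Proof. by apply/(inclP (image_submodule f)); exists x. Qed.

Definition rank M N (f : {linear M -> N}) : nat := kdim (im_module f : lmodType A).

Lemma image_corestrict M N (f : {linear M -> N}) :
  exists p : {linear M -> im_module f}, surjective p /\
    forall x, incl (image_submodule f) (p x) = f x.
Proof.
have [p pP] :=
  @lift_inj _ _ _ _ f (@incl_inj _ _ _ (image_submodule f)) (incl_im f).
exists p; split=> // u; have [x xu] := im_incl u.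
by exists x; apply: (@incl_inj _ _ _ (image_submodule f)); rewrite pP.
Qed.

Lemma fingen_im M N (f : {linear M -> N}) : fingen M -> fingen (im_module f).
Proof. by have [p [psurj _]] := image_corestrict f => /(kdim_surj psurj)[]. Qed.

Lemma rank_dom M N (f : {linear M -> N}) : fingen M -> (rank f <= kdim M)%N.
Proof. by have [p [psurj _]] := image_corestrict f => /(kdim_surj psurj)[]. Qed.

Lemma rank_eq0 M N (f : {linear M -> N}) : fingen M -> rank f = 0%N ->
  forall x, f x = 0.
Proof.
move=> Mfg rf0 x; have [p [psurj pP]] := image_corestrict f.
have [b bP] := kdimP (fingen_im f Mfg); rewrite -pP.
have [c ->] := bP (p x); rewrite /lincomb.
rewrite big1 ?linear0 // => i _; suff: False by [].
by case: i => i; rewrite [kdim _]rf0.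
Qed.

(** [g] induces a surjection from the image of [f] onto that of [h]; equal ranks make it
    bijective. *)
Lemma rank_compl M N X (f : {linear M -> N}) (g : {linear N -> X})
    (h : {linear M -> X}) : fingen M -> h =1 g \o f ->
  (rank h <= rank f)%N /\
  ((rank f <= rank h)%N -> forall x, g (f x) = 0 -> f x = 0).
Proof.
move=> Mfg hE; have [p [psurj pP]] := image_corestrict f.
have [|q qP] := @lift_inj _ _ _ _ (g \o incl (image_submodule f))
  (@incl_inj _ _ _ (image_submodule h)).
  move=> u; have [x <-] := psurj u; have [w wx] := incl_im h x; exists w.
  by rewrite wx hE /= pP.
have qsurj : surjective q.
  move=> v; have [x xv] := im_incl v.
  exists (p x); apply: (@incl_inj _ _ _ (image_submodule h)).
  by rewrite qP /= pP -xv hE.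
have [_ rhf qbij] := kdim_surj qsurj (fingen_im f Mfg); split=> // rfh x gfx.
suff px : p x = 0 by rewrite -pP px linear0.
apply: (bij_inj (qbij rfh)); rewrite linear0.
apply: (@incl_inj _ _ _ (image_submodule h)).
by rewrite qP /= pP gfx linear0.
Qed.

(** The image of [h] lies in that of [g], and equal ranks make them coincide. *)
Lemma rank_compr M N X (f : {linear M -> N}) (g : {linear N -> X})
    (h : {linear M -> X}) : fingen N -> h =1 g \o f ->
  (rank h <= rank g)%N /\
  ((rank g <= rank h)%N -> forall y, exists x, h x = g y).
Proof.
move=> Nfg hE.
have [|i iP] := @lift_inj _ _ _ _ (incl (image_submodule h))
  (@incl_inj _ _ _ (image_submodule g)).
  move=> u; have [x <-] := im_incl u; have [w wx] := incl_im g (f x).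
  by exists w; rewrite wx hE.
have iinj : injective i.
  by move=> u v uv; apply: (@incl_inj _ _ _ (image_submodule h)); rewrite -!iP uv.
have [_ rhg ibij] := kdim_inj iinj (fingen_im g Nfg); split=> // rgh y.
have [w wy] := incl_im g y.
have [u uw] := bij_surj (ibij rgh) w.
have [x xu] := im_incl u.
by exists x; rewrite xu -iP uw wy.
Qed.

Lemma indecomposable_sum X (S1 S2 : X -> Prop) : indecomposable X ->
  is_submodule S1 -> is_submodule S2 ->
  (forall x, S1 x -> S2 x -> x = 0) ->
  (forall x, exists y z, [/\ S1 y, S2 z & x = y + z]) ->
  (forall x, S1 x -> x = 0) \/ (forall x, S2 x -> x = 0).
Proof.
case=> _ _ Xind S1sub S2sub S12 Ssum.
pose U := submodule S1sub; pose V := submodule S2sub.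
pose f : {linear (U * V)%type -> X} := (incl S1sub \o fst) \+ (incl S2sub \o snd).
have fb : bijective f.
  apply: inj_surj_bij.
    apply: ker0_inj => -[u v]; rewrite /f /= => /eqP; rewrite addr_eq0 => /eqP uv.
    have Su : S1 (incl S1sub u) by apply/(inclP S1sub); exists u.
    have Sv : S2 (incl S2sub v) by apply/(inclP S2sub); exists v.
    have u0 : incl S1sub u = 0.
      apply: S12 => //; rewrite uv -scaleN1r -[X in S2 X]addr0.
      by apply: (proj2 S2sub) => //; apply: (proj1 S2sub).
    have v0 : incl S2sub v = 0 by apply/eqP; rewrite -oppr_eq0 -uv u0.
    congr pair; [apply: (@incl_inj _ _ _ S1sub) | apply: (@incl_inj _ _ _ S2sub)].
      by rewrite u0 linear0.
    by rewrite v0 linear0.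
  move=> x; have [y [z [/(inclP S1sub)[u <-] /(inclP S2sub)[v <-] ->]]] := Ssum x.
  by exists (u, v).
have XUV : isomorphic X (U * V)%type by apply: iso_sym; exists f.
have UV := Xind _ _ XUV.
have [U0|U0] := pselect (nonzero_module (U : lmodType A)); [right|left] => x Sx.
  have [v <-] := (inclP S2sub x).1 Sx.
  suff -> : v = 0 by rewrite linear0.
  by apply: contrapT => v0; apply: UV; split=> //; exists v.
have [u <-] := (inclP S1sub x).1 Sx.
suff -> : u = 0 by rewrite linear0.
by apply: contrapT => u0; apply: U0; exists u.
Qed.

(** [X] is the direct sum of the image of [s], which is nonzero, and the kernel of [g], which must
    then vanish. *)
Lemma indecomposable_retract X Z (g : {linear X -> Z}) (s : {linear Z -> X}) :
  indecomposable X -> nonzero_module Z -> cancel s g -> bijective g.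
Proof.
move=> Xind [z z0] sK.
have [|||] := indecomposable_sum Xind (image_submodule s) (ker_submodule g).
- by move=> _ [y <-]; rewrite sK => ->; rewrite linear0.
- move=> x; exists (s (g x)), (x - s (g x)); split; first by exists (g x).
    by rewrite linearB sK subrr.
  by rewrite addrC subrK.
- move=> /(_ (s z)) sz; case: z0; rewrite -(sK z) sz ?linear0 //.
  by exists z.
- by move=> ker0; apply: inj_surj_bij; [exact: ker0_inj | move=> y; exists (s y)].
Qed.

(** * Radical maps and the Harada-Sai bound *)

Definition rad_map b X Y (f : {linear X -> Y}) : Prop :=
  [/\ indecomposable X, indecomposable Y, (kdim X <= b)%N, (kdim Y <= b)%N &
      ~ bijective f].

(** Composites of [k + 1] radical maps between indecomposables of dimension at most [b]. *)
Fixpoint radpow b k X Y (f : {linear X -> Y}) : Prop :=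
  if k is k'.+1 then
    exists Z (h : {linear X -> Z}) (g : {linear Z -> Y}),
      [/\ rad_map b h, radpow b k' g & f =1 g \o h]
  else rad_map b f.

Lemma radpow_dom b k X Y (f : {linear X -> Y}) : radpow b k f ->
  indecomposable X /\ (kdim X <= b)%N.
Proof. by case: k => [|k] /= => [[]|[Z [h [g [[]]]]]]. Qed.

(** A chain of [k + l + 3] maps is cut into [k + 1] maps, one middle map and [l + 1] maps. *)
Lemma radpow_split b k l X Y (f : {linear X -> Y}) : radpow b (k + l).+2 f ->
  exists Z Z' (g : {linear X -> Z}) (h : {linear Z -> Z'}) (g' : {linear Z' -> Y}),
    [/\ radpow b k g, rad_map b h, radpow b l g' & f =1 g' \o h \o g].
Proof.
elim: k X f => [|k IHk] X f /=.
  move=> [Z [h [g [radh [Z' [h' [g' [radh' radg' gE]]]] fE]]]].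
  by exists Z, Z', h, h', g'; split=> // x; rewrite fE /= gE.
move=> [W [e [f' [rade + fE]]]] => /IHk[Z [Z' [g [h [g' [radg radh radg' f'E]]]]]].
exists Z, Z', (g \o e), h, g'; split=> //; last by move=> x; rewrite fE /= f'E.
by exists W, e, g.
Qed.

(* If the composite of [g], the radical map [h] and [g'] has the same rank as
   both [g] and [g'], then [im g] is a complement of [ker (g' h)] and [im (h g)]
   is a complement of [ker g'], which forces [h] to be bijective. *)
Lemma rank_drop b X Z Z' Y (g : {linear X -> Z}) (h : {linear Z -> Z'})
    (g' : {linear Z' -> Y}) (f : {linear X -> Y}) (r : nat) :
  fingen X -> rad_map b h -> f =1 g' \o h \o g ->
  (rank g <= r.+1)%N -> (rank g' <= r.+1)%N -> (rank f <= r)%N.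
Proof.
move=> Xfg [Zind Z'ind _ _ hbij] fE rg rg'; rewrite leqNgt; apply/negP => rf.
have [Zfg _ _] := Zind; have [Z'fg _ _] := Z'ind.
have [_ /(_ (leq_trans rg rf)) ginj] := @rank_compl _ _ _ g (g' \o h) f Xfg fE.
have [_ /(_ (leq_trans rg' rf)) gsurj] := @rank_compr _ _ _ (h \o g) g' f Z'fg fE.
have [x fx] : exists x, f x <> 0.
  apply: contrapT => f0; suff: rank f = 0%N by move=> rf0; rewrite rf0 in rf.
  apply/eqP; rewrite -leqn0; apply: kdim_min.
  exists (fun=> 0) => u; exists 0; rewrite lincomb0.
  apply: (@incl_inj _ _ _ (image_submodule f)); rewrite linear0.
  have [y <-] := im_incl u.
  by apply: contrapT => fy; apply: f0; exists y.
have gx : g x <> 0 by move=> gx; apply: fx; rewrite fE /= gx !linear0.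
apply: hbij; apply: inj_surj_bij.
  have [|||] := indecomposable_sum Zind (image_submodule g) (ker_submodule (g' \o h)).
  - by move=> _ [y <-]; exact: ginj.
  - move=> z; have [y yz] := gsurj (h z).
    exists (g y), (z - g y); split; first by exists y.
      by rewrite linearB /= -yz fE subrr.
    by rewrite addrC subrK.
  - by move=> /(_ (g x)) g0; case: gx; apply: g0; exists x.
  - move=> ker0; apply: ker0_inj => z hz; apply: ker0.
    by rewrite /= hz linear0.
have [|||] := indecomposable_sum Z'ind (image_submodule (h \o g)) (ker_submodule g').
- by move=> _ [y <-] /ginj /= ->; rewrite linear0.
- move=> z; have [y yz] := gsurj z.
  exists (h (g y)), (z - h (g y)); split; first by exists y.
    by rewrite linearB /= -yz fE subrr.
  by rewrite addrC subrK.
- move=> /(_ (h (g x))) hg0; case: fx; rewrite fE /= hg0 ?linear0 //.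
  by exists x.
- move=> ker0 z; have [y yz] := gsurj z; exists (g y).
  apply/eqP; rewrite -subr_eq0; apply/eqP/ker0.
  by rewrite linearB /= -yz fE subrr.
Qed.

(** By induction on [r], sufficiently long composites have rank at most [b - r]. *)
Lemma harada_sai b : exists k, forall X Y (f : {linear X -> Y}),
  radpow b k f -> forall x, f x = 0.
Proof.
suff rk r : exists k, forall X Y (f : {linear X -> Y}),
    radpow b k f -> (rank f <= b - r)%N.
  have [k kP] := rk b; exists k => X Y f rf x; apply: rank_eq0.
    by have [[]] := radpow_dom rf.
  by apply/eqP; rewrite -leqn0 -(subnn b); apply: kP.
elim: r => [|r [k kP]].
  exists 0%N => X Y f [[Xfg _ _] _ Xb _ _]; rewrite subn0.
  exact: leq_trans (rank_dom f Xfg) Xb.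
(* Two composites of rank at most [b - r] are joined by a radical map, which lowers the rank. *)
exists (k + k).+2 => X Y f /radpow_split[Z [Z' [g [h [g' [rg rh rg' fE]]]]]].
have [[Xfg _ _] _] := radpow_dom rg.
(* If [b <= r], truncated subtraction makes both bounds 0, and the bound for [g] suffices. *)
have [br|rb] := leqP b r.
  have fg := proj1 (@rank_compl _ _ _ g (g' \o h) f Xfg fE).
  apply: leq_trans fg _; apply: leq_trans (kP _ _ _ rg) _.
  by rewrite (eqP br) // (eqP (leqW br)).
apply: (rank_drop Xfg rh fE); rewrite subnSK //; exact: kP.
Qed.

(** Locality of the endomorphism ring. After normalizing the sum to the identity, a non-bijective
    [a'] is radical and acts as the identity on the kernel of [b']; its powers vanish eventually by
    [harada_sai], so [b'] is injective. *)
Lemma bij_add X (a b : {linear X -> X}) : indecomposable X ->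
  bijective (a \+ b) -> bijective a \/ bijective b.
Proof.
move=> Xind ab; apply: contrapT => /not_orP[aN bN].
have [Xfg [x x0] _] := Xind.
have [c [_ cK]] := bij_inv ab.
have endo_bij (f : {linear X -> X}) : injective f -> bijective f.
  by move=> finj; have [_ _] := kdim_inj finj Xfg; apply.
pose a' : {linear X -> X} := c \o a; pose b' : {linear X -> X} := c \o b.
have aE y : a y = (a \+ b) (a' y) by rewrite cK.
have bE y : b y = (a \+ b) (b' y) by rewrite cK.
have a'N : ~ bijective a'.
  by move=> a'b; apply: aN; apply: (eq_bij (bij_comp ab a'b)) => y; rewrite aE.
have b'ker y : b' y = 0 -> y = a' y.
  move=> b'y; apply: (bij_inj ab); rewrite -aE.
  suff by0 : b y = 0 by rewrite /= by0 addr0.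
  by rewrite bE b'y linear0.
apply: bN; suff b'b : bijective b'.
  by apply: (eq_bij (bij_comp ab b'b)) => y; rewrite bE.
apply: endo_bij.
have [k kP] := harada_sai (kdim X).
have radpow_iter m : exists f : {linear X -> X},
    radpow (kdim X) m f /\ forall y, b' y = 0 -> f y = y.
  elim: m => [|m [f [radf fP]]]; first by exists a'; split=> // y /b'ker.
  exists (f \o a'); split; first by exists X, a', f.
  by move=> y b'y; rewrite -[RHS]fP // [in RHS](b'ker y b'y).
have [f [radf fP]] := radpow_iter k.
by apply: ker0_inj => y /fP <-; apply: kP radf _.
Qed.
End HaradaSai.

(** * Factorizations and traces *)

Section Factorizations.
Variables (K : fieldType) (A : falgType K).
Implicit Types M N X Y Z U V W : lmodType A.

Lemma lin_pair V X Y (f : {linear V -> X}) (g : {linear V -> Y}) :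
  exists w : {linear V -> (X * Y)%type}, forall x, w x = (f x, g x).
Proof.
have lin_w : linear (fun x => (f x, g x)) by move=> a x y; rewrite !linearP.
by exists (lin_of lin_w).
Qed.

Lemma fingen_prod X Y : fingen X -> fingen Y -> fingen (X * Y)%type.
Proof.
move=> /kdimP[b bP] /kdimP[d dP].
pose I : finType := ('I_(kdim X) + 'I_(kdim Y))%type.
apply: (@spanned_fingen _ _ _ #|I|).
pose e (i : I) : (X * Y)%type :=
  match i with inl i => (b i, 0) | inr j => (0, d j) end.
apply: (spanned_fintype (b := e)) => -[x y].
have [[c ->] [c' ->]] := (bP x, dP y).
exists (fun i : I => match i with inl i => c 0 i | inr j => c' 0 j end).
rewrite big_sumType /= /e; congr (_, _).
  rewrite /= raddf_sum raddf_sum /=.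
  by rewrite [X in _ + X]big1 ?addr0 //= => i _; rewrite scaler0.
rewrite /= raddf_sum raddf_sum /=.
by rewrite [X in X + _]big1 ?add0r //= => i _; rewrite scaler0.
Qed.

(** The third clause says that the projections of the fibre product are jointly injective. *)
Lemma pullback X X' Y (p : {linear X' -> Y}) (h : {linear X -> Y}) :
  exists Z (a : {linear Z -> X'}) (b : {linear Z -> X}),
    [/\ forall z, p (a z) = h (b z),
        forall x' x, p x' = h x -> exists z, a z = x' /\ b z = x,
        forall z, a z = 0 -> b z = 0 -> z = 0 &
        fingen X' -> fingen X -> fingen Z].
Proof.
pose S (u : (X' * X)%type) := p u.1 = h u.2.
have Ssub : is_submodule S.
  by split=> [|a x y Sx Sy]; rewrite /S ?linear0 //= !linearP Sx Sy.
exists (submodule Ssub), (fst \o incl Ssub), (snd \o incl Ssub); split=> /=.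
- by move=> z; have : S (incl Ssub z) by apply/(inclP Ssub); exists z.
- move=> x' x /(inclP Ssub (x', x))[z zE]; exists z; by rewrite zE.
- move=> z az bz; apply: (@incl_inj _ _ _ Ssub); rewrite linear0.
  by rewrite [incl Ssub z]surjective_pairing az bz.
- move=> X'fg Xfg; have := fingen_prod X'fg Xfg;
  by case/(kdim_inj (@incl_inj _ _ _ Ssub)).
Qed.

(** If every surjection onto [X] splits, a section of the pullback of [p] along [h] lifts [h]
    through [p]. *)
Lemma nonprojective_epi X : fingen X -> ~ projective_module X ->
  exists Z (p : {linear Z -> X}), [/\ fingen Z, surjective p & ~ split_epi p].
Proof.
move=> Xfg Xproj; apply: contrapT => Nex; apply: Xproj; split=> //.
move=> X' Y X'fg _ p h psurj; have [Z [a [b [ab abP _ Zfg]]]] := pullback p h.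
have bsurj : surjective b.
  by move=> x; have [x' /abP[z [_ bz]]] := psurj (h x); exists z.
have [[s sP]|bN] := pselect (split_epi b); last first.
  by case: Nex; exists Z, b; split=> //; apply: Zfg.
by exists (a \o s) => x /=; rewrite ab sP.
Qed.

Lemma split_epi_bij X Y (g : {linear Y -> X}) :
  indecomposable Y -> nonzero_module X -> split_epi g -> bijective g.
Proof. by move=> Yind X0 [s sP]; apply: indecomposable_retract Yind X0 sP. Qed.

Lemma bij_split_epi X Y (g : {linear Y -> X}) : bijective g -> split_epi g.
Proof. by move=> /bij_inv[s [_ sP]]; exists s. Qed.

(** [v] is a finite sum of composites of maps [u] with maps [g] in [F]. The inductive form avoids
    finite families of maps with varying sources. *)
Inductive factors X (F : forall Y, {linear Y -> X} -> Prop) V :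
    {linear V -> X} -> Prop :=
| factors0 (v : {linear V -> X}) : (forall x, v x = 0) -> factors F v
| factorsD Y (g : {linear Y -> X}) (u : {linear V -> Y})
    (v' v : {linear V -> X}) :
    F Y g -> factors F v' -> (forall x, v x = g (u x) + v' x) -> factors F v.

Section FactorsTheory.
Variables (X : lmodType A) (F : forall Y, {linear Y -> X} -> Prop).

Lemma factors_ext V (v v' : {linear V -> X}) :
  factors F v -> v' =1 v -> factors F v'.
Proof.
case=> [w w0|Y g u w' w Fg Fw' wE] vE.
  by apply: factors0 => x; rewrite vE.
by apply: factorsD Fg Fw' _ => x; rewrite vE; apply: wE.
Qed.

Lemma factors_one V Y (g : {linear Y -> X}) (u : {linear V -> Y})
    (v : {linear V -> X}) : F g -> v =1 g \o u -> factors F v.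
Proof.
move=> Fg vE; apply: (factorsD (u := u) (v' := \0) Fg).
  exact: factors0.
by move=> x; rewrite vE addr0.
Qed.

Lemma factors_gen Y (g : {linear Y -> X}) : F g -> factors F g.
Proof. by move=> Fg; apply: (factors_one (u := idfun) Fg). Qed.

Lemma factors_add V (v1 v2 v : {linear V -> X}) :
  factors F v1 -> factors F v2 -> v =1 v1 \+ v2 -> factors F v.
Proof.
move=> Fv1 Fv2; elim: Fv1 v => {v1} [v1 v10|Y g u v' v1 Fg _ IH v1E] v vE.
  by apply: factors_ext Fv2 _ => x; rewrite vE /= v10 add0r.
apply: (factorsD (u := u) (v' := v' \+ v2) Fg); first exact: IH.
by move=> x; rewrite vE /= v1E addrA.
Qed.

Lemma factors_pre V W (v : {linear V -> X}) (w : {linear W -> V}) :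
  factors F v -> factors F (v \o w).
Proof.
elim=> {v} [v v0|Y g u v' v Fg _ IH vE]; first by apply: factors0 => x /=.
by apply: (factorsD (u := u \o w) (v' := v' \o w) Fg) => // x /=.
Qed.

End FactorsTheory.

(** Substitution of factorizations. The hypothesis mentions a map [u] out of [V], so that properties
    of [V] can be used in each replacement. *)
Lemma factors_bind X X' (p : {linear X -> X'})
    (F : forall Y, {linear Y -> X} -> Prop)
    (F' : forall Y, {linear Y -> X'} -> Prop) V (v : {linear V -> X}) :
  (forall Y (g : {linear Y -> X}) (u : {linear V -> Y}),
     F Y g -> factors F' (p \o g \o u)) ->
  factors F v -> factors F' (p \o v).
Proof.
move=> FF'; elim=> {v} [v v0|Y g u v' v Fg _ IH vE].
  by apply: factors0 => x /=; rewrite v0 linear0.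
by apply: factors_add (FF' _ _ u Fg) IH _ => x /=; rewrite vE linearD.
Qed.

Lemma factors_bind_id X (F F' : forall Y, {linear Y -> X} -> Prop) V
    (v : {linear V -> X}) :
  (forall Y (g : {linear Y -> X}) (u : {linear V -> Y}),
     F Y g -> factors F' (g \o u)) ->
  factors F v -> factors F' v.
Proof.
move=> FF' Fv; apply: (@factors_ext _ _ _ (idfun \o v)) => //.
by apply: factors_bind Fv => Y g u /(FF' _ _ u)/factors_ext; apply.
Qed.

Lemma factors_nonzero X (F : forall Y, {linear Y -> X} -> Prop) V
    (v : {linear V -> X}) x :
  factors F v -> v x <> 0 -> exists Y (g : {linear Y -> X}), F Y g.
Proof. by case=> [w w0|Y g u v' w Fg _ _] vx0; [case: vx0 | exists Y, g]. Qed.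

Lemma factors_lift X U (i : {linear U -> X})
    (F : forall Y, {linear Y -> X} -> Prop)
    (F' : forall Y, {linear Y -> U} -> Prop) V (v : {linear V -> X}) :
  (forall Y (g : {linear Y -> X}), F Y g ->
     exists h : {linear Y -> U}, g =1 i \o h /\ F' Y h) ->
  factors F v -> exists v' : {linear V -> U}, v =1 i \o v' /\ factors F' v'.
Proof.
move=> FF'; elim=> {v} [v v0|Y g u v' v Fg _ [w [wE Fw]] vE].
  exists \0; split; last exact: factors0.
  by move=> x; rewrite v0 /= linear0.
have [h [gE Fh]] := FF' _ _ Fg; exists ((h \o u) \+ w); split.
  by move=> x; rewrite vE wE gE /= linearD.
by apply: (factorsD Fh Fw).
Qed.

Lemma factors_sub X (F F' : forall Y, {linear Y -> X} -> Prop) V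
    (v : {linear V -> X}) :
  (forall Y (g : {linear Y -> X}), F Y g -> F' Y g) ->
  factors F v -> factors F' v.
Proof.
move=> FF'; apply: factors_bind_id => Y g u /FF' Fg.
exact: (factors_one (u := u) Fg).
Qed.

(** * Traces, decompositions and direct sums *)

(** The sum of the images of the maps in [F]; one [v] suffices for each element, since sums are
    absorbed by products of the sources. *)
Definition trace X (F : forall Y, {linear Y -> X} -> Prop) (x : X) : Prop :=
  exists V (v : {linear V -> X}) w, factors F v /\ v w = x.

Lemma factors_trace X (F : forall Y, {linear Y -> X} -> Prop) V
  (v : {linear V -> X}) w : factors F v -> trace F (v w).
Proof. by move=> Fv; exists V, v, w. Qed.

Lemma trace_submodule X (F : forall Y, {linear Y -> X} -> Prop) :
  is_submodule (trace F).
Proof.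
split; first by exists X, \0, 0; split=> //; apply: factors0.
move=> a _ _ [V [v [w [Fv <-]]]] [V' [v' [w' [Fv' <-]]]].
exists (V * V')%type, ((v \o fst) \+ (v' \o snd)), (a *: w, w'); split.
  by apply: (factors_add (v1 := v \o fst) (v2 := v' \o snd)) => //;
     apply: factors_pre.
by rewrite /= linearZ.
Qed.

Lemma trace_min X (F : forall Y, {linear Y -> X} -> Prop) (S : X -> Prop) x :
  is_submodule S -> (forall Y (g : {linear Y -> X}) y, F Y g -> S (g y)) ->
  trace F x -> S x.
Proof.
case=> S0 SP FS [V [v [w [Fv <-]]]].
elim: Fv w => {v} [v v0|Y g u v' v Fg _ IH vE] w; first by rewrite v0.
by rewrite vE -[g _]scale1r; apply: SP => //; apply: FS.
Qed.

Lemma trace_map X X' (p : {linear X -> X'})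
    (F : forall Y, {linear Y -> X} -> Prop)
    (F' : forall Y, {linear Y -> X'} -> Prop) x :
  (forall Y (g : {linear Y -> X}) y, F Y g -> trace F' (p (g y))) ->
  trace F x -> trace F' (p x).
Proof.
move=> FF'; apply: (@trace_min X F (fun x => trace F' (p x))) => //.
have [T0 TP] := trace_submodule F'; split; first by rewrite linear0.
by move=> a y z Ty Tz; rewrite linearP; apply: TP.
Qed.

Lemma trace_bind X (F F' : forall Y, {linear Y -> X} -> Prop) x :
  (forall Y (g : {linear Y -> X}) y, F Y g -> trace F' (g y)) ->
  trace F x -> trace F' x.
Proof. by move=> FF'; apply: (trace_min (trace_submodule F')). Qed.

Lemma trace_gen X (F : forall Y, {linear Y -> X} -> Prop) Y
  (g : {linear Y -> X}) y : F Y g -> trace F (g y).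
Proof. by move=> Fg; apply/factors_trace/factors_gen. Qed.

Lemma trace_surj X (F : forall Y, {linear Y -> X} -> Prop) :
  fingen X -> (forall x, trace F x) ->
  exists V (v : {linear V -> X}), factors F v /\ surjective v.
Proof.
case=> l lP Ftr.
suff [V [v [Fv vl]]] : exists V (v : {linear V -> X}),
    factors F v /\ forall i, (i < size l)%N -> exists w, v w = l`_i.
  exists V, v; split=> // x; have [a ->] := lP x.
  have [im0 imP] := image_submodule v.
  elim/big_ind: _ => [//|y z|i _]; first by rewrite -{2}[y]scale1r; apply: imP.
  by rewrite -[a i *: _]addr0; apply: imP => //; apply: vl.
elim: l {lP} => [|x l [V [v [Fv vl]]]].
  by exists X, \0; split=> //; apply: factors0.
have [V' [v' [w' [Fv' v'w]]]] := Ftr x.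
exists (V' * V)%type, ((v' \o fst) \+ (v \o snd)); split.
  by apply: (factors_add (v1 := v' \o fst) (v2 := v \o snd)) => //;
     apply: factors_pre.
case=> [_|i /vl[w vw]]; first by exists (w', 0); rewrite /= linear0 addr0.
by exists (0, w); rewrite /= linear0 add0r.
Qed.

Lemma factors_direct_sum X (F : forall Y, {linear Y -> X} -> Prop) V
    (v : {linear V -> X}) : factors F v ->
  exists s (p : {linear direct_sum s -> X}) (u : {linear V -> direct_sum s}),
    List.Forall (fun Y => exists g : {linear Y -> X}, F Y g) s /\ v =1 p \o u.
Proof.
elim=> {v} [v v0|Y g u v' v Fg _ [s [p [u' [Fs v'E]]]] vE].
  by exists [::], \0, \0; split.
have [w wE] := lin_pair u u'.
exists (Y :: s), ((g \o fst) \+ (p \o snd)), w; split.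
  by constructor=> //; exists g.
by move=> x; rewrite vE v'E /= wE.
Qed.

Lemma direct_sum_factors X (D : lmodType A -> Prop) s
    (v : {linear direct_sum s -> X}) : List.Forall D s ->
  factors (fun Y (_ : {linear Y -> X}) => D Y) v.
Proof.
elim: s v => [|Y s IHs] v Ds.
  by apply: factors0 => x; rewrite [x]thinmx0 linear0.
have [inl inlE] := @lin_pair Y Y (direct_sum s) idfun \0.
have [inr inrE] := @lin_pair (direct_sum s) Y (direct_sum s) \0 idfun.
have [DY Ds'] : D Y /\ List.Forall D s by inversion Ds.
apply: (@factorsD _ _ _ Y (v \o inl) fst ((v \o inr) \o snd)) => //.
  by apply: factors_pre; apply: IHs.
case=> y z /=; rewrite inlE inrE -linearD; congr (v _).
by congr (_, _); rewrite /= ?addr0 ?add0r.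
Qed.

(** Existence of a decomposition into indecomposables, by induction on the dimension, in the form of
    a sum expression for the identity. *)
Lemma fingen_decomp M : fingen M ->
  factors (fun Y (g : {linear Y -> M}) => indecomposable Y /\ split_mono g)
    (idfun : {linear M -> M}).
Proof.
have [n] := ubnP (kdim M); elim: n M => // n IHn M Mn Mfg.
have [M0|M0] := pselect (nonzero_module M); last first.
  by apply: factors0 => x; apply: contrapT => x0; apply: M0; exists x.
have [Mind|Mdec] := pselect (indecomposable M).
  by apply: factors_gen; split=> //; exists idfun.
have [X [Y [[f fb] [X0 Y0]]]] :
    exists X Y, isomorphic M (X * Y)%type /\ nonzero_module X /\ nonzero_module Y.
  apply: contrapT => Nex; apply: Mdec; split=> // X Y MXY XY0.
  by apply: Nex; exists X, Y.
have [f' [fK f'K]] := bij_inv fb.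
have [inl inlE] := @lin_pair X X Y idfun \0.
have [inr inrE] := @lin_pair Y X Y \0 idfun.
(* A proper retract has smaller dimension; its decomposition is transported along [i] and [r]. *)
have part Z (i : {linear Z -> M}) (r : {linear M -> Z}) :
    cancel i r -> ~ surjective i ->
    factors (fun Y (g : {linear Y -> M}) => indecomposable Y /\ split_mono g)
      (i \o r).
  move=> iK isurj; have [Zfg ZM Zbij] := kdim_inj (can_inj iK) Mfg.
  have ZltM : (kdim Z < kdim M)%N.
    by rewrite ltnNge; apply/negP => /Zbij/bij_surj.
  apply: (@factors_ext _ _ _ ((i \o idfun) \o r)) => //.
  apply: factors_pre; apply: factors_bind (IHn Z _ Zfg); last first.
    by rewrite -ltnS (leq_trans _ Mn).
  move=> W g u [Wind [s sP]].
  apply: (factors_one (g := i \o g) (u := u)) => //; split=> //.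
  by exists (s \o r) => x /=; rewrite iK sP.
apply: (factors_add (v1 := (f' \o inl) \o (fst \o f))
                    (v2 := (f' \o inr) \o (snd \o f))).
- apply: part => [x|isurj] /=; first by rewrite f'K inlE.
  have [y y0] := Y0; have [x /= xy] := isurj (f' (0, y)).
  by apply: y0; move/(congr1 (snd \o f)): xy; rewrite /= !f'K inlE.
- apply: part => [x|isurj] /=; first by rewrite f'K inrE.
  have [y y0] := X0; have [x /= xy] := isurj (f' (y, 0)).
  by apply: y0; move/(congr1 (fst \o f)): xy; rewrite /= !f'K inrE.
move=> x /=; rewrite -linearD inlE inrE -[LHS]fK; congr (f' _).
by case: (f x) => y z; congr (_, _); rewrite /= ?addr0 ?add0r.
Qed.

(** By locality some summand of [v] is bijective; its [g] is then a split epimorphism from an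
    indecomposable, hence bijective. *)
Lemma factors_bij X (F : forall Y, {linear Y -> X} -> Prop)
    (v : {linear X -> X}) :
  indecomposable X -> (forall Y (g : {linear Y -> X}), F Y g -> indecomposable Y) ->
  factors F v -> bijective v ->
  exists Y (g : {linear Y -> X}), F Y g /\ bijective g.
Proof.
move=> Xind Find; elim=> {v} [v v0|Y g u v' v Fg _ IH vE] vbij.
  have [_ [x x0] _] := Xind; case: x0; apply: (bij_inj vbij).
  by rewrite !v0.
have [|gu|] := @bij_add _ _ _ (g \o u) v' Xind; last exact: IH.
  by apply: (eq_bij vbij) => x; rewrite vE.
exists Y, g; split=> //; have [_ X0 _] := Xind.
apply: split_epi_bij (Find _ _ Fg) X0 _.
by have [c [_ cK]] := bij_inv gu; exists (u \o c).
Qed.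

End Factorizations.

(** * Right almost split maps *)

Section AlmostSplit.
Variables (K : fieldType) (A : falgType K).
Implicit Types B E L M N X Y Z U V W : lmodType A.

Lemma iso_prod0 M : isomorphic M (M * 'rV[A]_0)%type.
Proof.
have [i iE] := @lin_pair _ _ M M 'rV[A]_0 idfun \0.
by exists i; exists fst => [x|[x y]]; rewrite iE //= [y]thinmx0.
Qed.

Lemma fingen_rV0 : @fingen K A 'rV[A]_0.
Proof. by exists [::] => x; exists (fun=> 0); rewrite big_ord0 [x]thinmx0. Qed.

(** [B] consists of [m] copies of [Y], and [beta] has the components [r i]. *)
Lemma combination_factors X Y m (r : 'I_m -> {linear Y -> X})
    (F : forall Z, {linear Z -> X} -> Prop) :
  fingen Y -> (forall i, F Y (r i)) ->
  exists B (beta : {linear B -> X}), [/\ fingen B, factors F beta &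
    forall c : 'rV[K]_m, exists h : {linear Y -> B},
      forall y, lincomb (r^~ y) c = beta (h y)].
Proof.
move=> Yfg; elim: m r => [|m IHm] r Fr.
  exists 'rV[A]_0, \0; split; [exact: fingen_rV0 | exact: factors0 |].
  by move=> c; exists \0 => y; rewrite /lincomb big_ord0.
have [B [beta [Bfg Fbeta betaP]]] := IHm (fun i => r (lift ord0 i)) (fun i => Fr _).
exists (Y * B)%type, ((r ord0 \o fst) \+ (beta \o snd)); split.
- exact: fingen_prod.
- by apply: (factorsD (u := fst) (Fr ord0) (factors_pre snd Fbeta)).
move=> c; have [h hP] := betaP (\row_i c 0 (lift ord0 i)).
(* Scaling by [K] is [A]-linear because [K] is central in [A]. *)
have scl : linear (fun y : Y => (c 0 ord0)%:A *: y).
  by move=> a x y; rewrite scalerDr !scalerA -scalerAl mul1r -scalerAr mulr1.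
have [w wE] := lin_pair (lin_of scl) h; exists w => y.
rewrite wE /= -hP /lincomb big_ord_recl linearZ; congr (_ + _).
by apply: eq_bigr => i _; rewrite mxE.
Qed.

(** Each indecomposable [L] of the list contributes one copy for each member of a finite family
    spanning the non-isomorphisms from [L] to [X]. *)
Lemma finite_approximation X (l : seq (lmodType A)) : fingen X ->
  exists B (beta : {linear B -> X}), [/\ fingen B,
    factors (fun Y (g : {linear Y -> X}) => indecomposable Y /\ ~ bijective g)
      beta &
    forall Y (g : {linear Y -> X}), indecomposable Y ->
      List.Exists (isomorphic Y) l -> ~ bijective g ->
      exists h : {linear Y -> B}, g =1 beta \o h].
Proof.
move=> Xfg; elim: l => [|L l [B [beta [Bfg Fbeta betaP]]]].
  exists 'rV[A]_0, \0; split; [exact: fingen_rV0 | exact: factors0 |].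
  by move=> Y g _ Yl; inversion Yl.
have [Lind|Ldec] := pselect (indecomposable L); last first.
  exists B, beta; split=> // Y g Yind Yl; apply: betaP => //.
  inversion Yl => //; case: Ldec; exact: iso_indecomposable Yind.
have [Lfg _ _] := Lind.
have [m [r [rS rP]]] := hom_basis (fun g => ~ bijective g) Lfg Xfg.
have Fr i : indecomposable L /\ ~ bijective (r i) by [].
have [B' [beta' [B'fg Fbeta' beta'P]]] :=
  @combination_factors _ _ _ r (fun Y g => indecomposable Y /\ ~ bijective g) Lfg Fr.
exists (B' * B)%type, ((beta' \o fst) \+ (beta \o snd)); split.
- exact: fingen_prod.
- by apply: (factors_add (factors_pre fst Fbeta') (factors_pre snd Fbeta)).
move=> Y g Yind Yl gN; have [[i ib]|YL] := pselect (isomorphic Y L).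
  have [j [iK jK]] := bij_inv ib.
  have gjN : ~ bijective (g \o j).
    move=> gj; apply: gN; apply: (eq_bij (bij_comp gj ib)) => y /=.
    by rewrite iK.
  have [c cP] := rP _ gjN; have [h hP] := beta'P c.
  have [w wE] := @lin_pair _ _ Y B' B (h \o i) \0; exists w => y.
  by rewrite /= wE /= linear0 addr0 -hP -cP /= iK.
have [|h hP] := betaP _ g Yind _ gN; first by inversion Yl.
have [w wE] := @lin_pair _ _ Y B' B \0 h; exists w => y.
by rewrite /= wE /= linear0 add0r.
Qed.

Lemma factors_through X E (g : {linear E -> X}) V (v : {linear V -> X}) :
  factors (fun Y (h : {linear Y -> X}) => exists c : {linear Y -> E}, h =1 g \o c)
    v ->
  exists c : {linear V -> E}, v =1 g \o c.
Proof.
elim=> {v} [v v0|Y h u v' v [c hE] _ [c' v'E] vE].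
  by exists \0 => x; rewrite /= v0 linear0.
by exists ((c \o u) \+ c') => x; rewrite vE hE v'E /= linearD.
Qed.

Definition right_almost_split X E (g : {linear E -> X}) : Prop :=
  [/\ fingen E, ~ split_epi g & forall W (b : {linear W -> X}),
      fingen W -> ~ split_epi b -> exists c : {linear W -> E}, b =1 g \o c].

(** A source of least dimension stands in for right minimality. *)
Lemma minimal_almost_split X E0 (g0 : {linear E0 -> X}) :
  right_almost_split g0 ->
  exists E (g : {linear E -> X}), right_almost_split g /\
    forall E' (g' : {linear E' -> X}),
      right_almost_split g' -> (kdim E <= kdim E')%N.
Proof.
move=> g0P.
pose Q n := `[< exists E (g : {linear E -> X}), right_almost_split g /\ kdim E = n >].
have exQ : exists n, Q n by exists (kdim E0); apply/asboolP; exists E0, g0.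
case: (ex_minnP exQ) => n /asboolP[E [g [gP <-]]] nmin.
by exists E, g; split=> // E' g' g'P; apply: nmin; apply/asboolP; exists E', g'.
Qed.

(** The restriction of [g] to the image of [phi] is again right almost split, so this image has full
    dimension. *)
Lemma minimal_almost_split_mono X E (g : {linear E -> X}) (phi : {linear E -> E}) :
  right_almost_split g ->
  (forall E' (g' : {linear E' -> X}),
     right_almost_split g' -> (kdim E <= kdim E')%N) ->
  g \o phi =1 g -> injective phi.
Proof.
move=> [Efg gN gP] gmin gphi; have [p [psurj pE]] := image_corestrict phi.
have [_ _ pbij] := kdim_surj psurj Efg.
suff /gmin/pbij/bij_inj pinj : right_almost_split (g \o incl (image_submodule phi)).
  move=> x y xy; apply: pinj; apply: (@incl_inj _ _ _ (image_submodule phi)).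
  by rewrite !pE.
split; first exact: fingen_im.
  by case=> s sP; apply: gN; exists (incl (image_submodule phi) \o s).
move=> W b Wfg /(gP _ _ Wfg)[c cE]; exists (p \o c) => w.
by rewrite /= pE cE -[g (phi _)]/((g \o phi) _) gphi.
Qed.

(** If [g \o i] is [b \o a] with [b] not a split epimorphism, then [b] is [g \o c]. Exchanging [i]
    for [c \o a] on the summand [Y] gives an endomorphism compatible with [g], hence injective; so
    [r \o c \o a] is bijective and [a] splits. *)
Lemma minimal_almost_split_irreducible X E (g : {linear E -> X}) :
  indecomposable X -> right_almost_split g ->
  (forall E' (g' : {linear E' -> X}),
     right_almost_split g' -> (kdim E <= kdim E')%N) ->
  forall Y (i : {linear Y -> E}), indecomposable Y -> split_mono i ->
    irreducible_morphism (g \o i).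
Proof.
move=> Xind gras gmin Y i Yind [r iK]; have [Efg gN gP] := gras.
have [Yfg Y0 _] := Yind.
have giN : ~ split_epi (g \o i).
  by case=> s sP; apply: gN; exists (i \o s).
split=> //.
  case=> t tK; apply: giN; exists t => x.
  have tbij := indecomposable_retract Xind Y0 tK.
  by apply: (bij_inj tbij); rewrite tK.
move=> W Wfg a b gi; have [bs|bN] := pselect (split_epi b); [by right | left].
have [c cE] := gP _ _ Wfg bN.
pose phi : {linear E -> E} := (idfun \- (i \o r)) \+ (c \o a \o r).
have phiE x : phi x = x - i (r x) + c (a (r x)) by [].
have gphi x : g (phi x) = g x.
  by rewrite phiE linearD linearB -[g (i _)]/((g \o i) (r x)) gi /= cE subrK.
have phi_inj := minimal_almost_split_mono gras gmin gphi.
have ca_inj : injective (r \o c \o a).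
  apply: ker0_inj => y /= cay.
  (* [r e = y] because [r (c (a y)) = 0], and therefore [phi] kills [e]. *)
  pose e := i y - c (a y).
  have re : r e = y by rewrite /e raddfB /= iK cay subr0.
  suff e0 : e = 0 by rewrite -re e0 linear0.
  apply: phi_inj; rewrite linear0 phiE re /e.
  by rewrite [i y - _]addrC addrK addNr.
have [_ _ /(_ (leqnn _)) ca_bij] := kdim_inj ca_inj Yfg.
by have [d [dK _]] := bij_inv ca_bij; exists (d \o r \o c) => y; apply: dK.
Qed.

Lemma almost_split_factors X E (g : {linear E -> X}) W (b : {linear W -> X}) :
  indecomposable X -> right_almost_split g -> fingen W -> ~ split_epi b ->
  factors (fun Y (h : {linear Y -> X}) =>
             indecomposable Y /\ irreducible_morphism h) b.
Proof.
move=> Xind /minimal_almost_split{E g}[E [g [gras gmin]]] Wfg bN.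
have [Efg _ gP] := gras; have [c cE] := gP _ _ Wfg bN.
apply: (@factors_ext _ _ _ _ _ ((g \o idfun) \o c)) => //; apply: factors_pre.
apply: factors_bind (fingen_decomp Efg) => Y i u [Yind imono].
apply: (factors_one (g := g \o i) (u := u)) => //; split=> //.
exact: (minimal_almost_split_irreducible Xind gras gmin).
Qed.

End AlmostSplit.

(** * The postprojective partition *)

Section Partition.
Variables (K : fieldType) (A : falgType K).
Implicit Types B E L M N X Y Z U V W : lmodType A.
Variable P : option nat -> lmodType A -> Prop.
Hypothesis HP : postprojective_partition P.

Definition tail (n : nat) X : Prop := exists i, geq_index n i /\ P i X.

Lemma part_indecomposable i X : P i X -> indecomposable X.
Proof. by case: HP => /(_ i)[Pind _] _ _; apply: Pind. Qed.

Lemma part_iso i X Y : isomorphic X Y -> P i X -> P i Y.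
Proof. by case: HP => /(_ i)[_ Piso] _ _; apply: Piso. Qed.

Lemma part_unique i j X : P i X -> P j X -> i = j.
Proof.
move=> Pi Pj; have [_ /(_ X (part_indecomposable Pi))[k [_ kP]] _] := HP.
by rewrite -(kP _ Pi) -(kP _ Pj).
Qed.

Lemma part_index X : indecomposable X -> exists i, P i X.
Proof. by have [_ + _] := HP => /(_ X) PX /PX[i [Pi _]]; exists i. Qed.

Lemma bij_index i j X Y (g : {linear X -> Y}) :
  bijective g -> P i X -> P j Y -> i = j.
Proof. by move=> gb Pi; apply: part_unique; apply: part_iso Pi; exists g. Qed.

Lemma tail_trace n M : tail n M ->
  forall x, trace (fun Y (_ : {linear Y -> M}) => P (Some n) Y) x.
Proof.
move=> Mn; have [_ _ /(_ n)[_ [[_ cov] _]]] := HP.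
have [Z [[s [M' [Ds [f fb]]]] [p psurj]]] := cov M Mn.
move=> x; have [z <-] := psurj x.
have [y yz] := bij_surj fb (z, 0).
have -> : p z = ((p \o fst) \o f) y by rewrite /= yz.
exact/factors_trace/direct_sum_factors.
Qed.

(* If these maps generated [X], composing their sources with covers by
   [P (Some n)] would write [X] as the sum of the trace of the other members of
   [P (Some n)] and of the images of radical endomorphisms; iterating, the
   latter vanish, and [P (Some n)] without [X] would still be a cover. *)
Lemma tail_trace_proper n X : P (Some n) X ->
  ~ forall x, trace (fun Y (g : {linear Y -> X}) => tail n Y /\ ~ bijective g) x.
Proof.
move=> PX Xtr; have [_ _ /(_ n)[_ [_ Pmin]]] := HP.
have Xind := part_indecomposable PX; have [Xfg X0 _] := Xind.
(* [D] is [P (Some n)] without the class of [X]; [F k] also admits composites of [k + 1] radical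
   maps starting at a copy of [X]. *)
pose D Y := P (Some n) Y /\ ~ isomorphic X Y.
pose F k Z := fun Y (g : {linear Y -> Z}) =>
  D Y \/ (isomorphic X Y /\ radpow (kdim X) k g).
have F0 Z : isomorphic X Z -> forall z, trace (F 0%N Z) z.
  case=> i ib z; have Zind : indecomposable Z.
    by apply: iso_indecomposable Xind; exists i.
  have [x <-] := bij_surj ib z.
  apply: trace_map (Xtr x) => Y g y [Yn gN].
  have Yind : indecomposable Y by case: Yn => j [_ /part_indecomposable].
  apply: (trace_map (p := i \o g)) (tail_trace Yn y) => W u w PW.
  apply: (trace_gen (g := i \o g \o u)).
  have [XW|XW] := pselect (isomorphic X W); [right | by left].
  have Wind := part_indecomposable PW.
  split=> //; split=> //; first by rewrite (iso_kdim XW).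
    by rewrite -(@iso_kdim _ _ X Z) //; exists i.
  (* Bijectivity of the composite would make [g] a split epimorphism from an indecomposable, hence
     bijective. *)
  move=> igu; apply: gN; apply: split_epi_bij => //.
  have gu : bijective (g \o u).
    have [j [iK jK]] := bij_inv ib; have jb : bijective j by exists i.
    by apply: (eq_bij (bij_comp jb igu)) => y' /=; rewrite iK.
  by have [t [_ tK]] := bij_inv gu; exists (u \o t).
have FS k Z : isomorphic X Z -> forall z, trace (F k Z) z.
  move=> XZ z; elim: k => [|k IHk]; first exact: F0.
  apply: trace_bind IHk => Y g y [DY|[XY radg]].
    by apply: trace_gen; left.
  apply: trace_map (F0 _ XY y) => W u w [DW|[XW radu]];
    apply: (trace_gen (g := g \o u)); [by left | right; split=> //].
  by exists Y, u, g.
have [k kP] := @harada_sai K A (kdim X).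
have DX Z : isomorphic X Z ->
    forall z, trace (fun Y (_ : {linear Y -> Z}) => D Y) z.
  move=> XZ z; apply: trace_bind (FS k Z XZ z) => Y g y [DY|[_ /kP ->]].
    exact: trace_gen.
  by case: (trace_submodule (fun Y (_ : {linear Y -> Z}) => D Y)).
(* Minimality would put [X] in [D], although [X] is isomorphic to itself. *)
suff /(_ X PX)[_] : forall Y, P (Some n) Y -> D Y by apply; apply: iso_refl.
apply: Pmin => [|Y [] //|].
  split=> [Y [/part_indecomposable//]|Y Z YZ [PY XY]].
  split; first exact: part_iso PY.
  by move=> XZ; apply: XY; apply: iso_trans XZ (iso_sym YZ).
split=> [Y [PY _]|M Mn]; first by exists (Some n); split=> //=.
have Mfg : fingen M by case: Mn => i [_ /part_indecomposable[]].
have DM x : trace (fun Y (_ : {linear Y -> M}) => D Y) x.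
  apply: trace_bind (tail_trace Mn x) => Y g y PY.
  have [XY|XY] := pselect (isomorphic X Y); last exact: trace_gen.
  apply: trace_map (DX Y XY y) => Z u z DZ.
  exact: (trace_gen (F := fun Y _ => D Y) (g := g \o u)).
have [V [v [Fv vsurj]]] := trace_surj Mfg DM.
have [s [p [u [Ds vE]]]] := factors_direct_sum Fv.
exists (direct_sum s); split.
  exists s, 'rV[A]_0; split; last exact: iso_prod0.
  by apply: List.Forall_impl Ds => Y [].
exists p => y; have [x <-] := vsurj y; exists (u x); by rewrite vE.
Qed.

Lemma finite_below n : exists l : seq (lmodType A), forall j Y,
  (j < n)%N -> P (Some j) Y -> List.Exists (isomorphic Y) l.
Proof.
elim: n => [|n [l lP]]; first by exists [::].
have [_ _ /(_ n)[[l' l'P] _]] := HP; exists (l' ++ l) => j Y.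
rewrite ltnS leq_eqVlt => /orP[/eqP ->|jn] PY; apply/List.Exists_app.
  by left; apply: l'P.
by right; apply: lP PY.
Qed.

Lemma almost_split n X : P (Some n) X ->
  exists E (g : {linear E -> X}), right_almost_split g.
Proof.
move=> PX; have Xind := part_indecomposable PX; have [Xfg X0 _] := Xind.
pose F Y (g : {linear Y -> X}) := tail n Y /\ ~ bijective g.
have Tsub := trace_submodule F; pose i := incl Tsub.
have [l lP] := finite_below n.
have [B [beta [Bfg Fbeta betaP]]] := finite_approximation l Xfg.
pose g : {linear (submodule Tsub * B)%type -> X} := (i \o fst) \+ (beta \o snd).
exists _, g; split.
- apply: fingen_prod => //.
  by have [] := kdim_inj (@incl_inj _ _ _ Tsub) Xfg.
(* A section writes the identity of [X] as a map through the trace plus a map through [beta]. By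
   locality one is bijective: then the trace is all of [X], or some non-isomorphism is bijective. *)
- case=> s sP; have [|ib|] := @bij_add _ _ _ (i \o fst \o s) (beta \o snd \o s) Xind.
  + by exists idfun => x; rewrite -[RHS]sP.
  + apply: (tail_trace_proper PX) => x; apply/(inclP Tsub).
    by have [y <-] := bij_surj ib x; exists (s y).1.
  + have /factors_bij := factors_pre (snd \o s) Fbeta.
    by move=> H /(H Xind)[|Y [h [[_ hN] /hN]]] // Y h [].
move=> W b Wfg bN; suff: factors (fun Y (h : {linear Y -> X}) =>
    exists c : {linear Y -> (submodule Tsub * B)%type}, h =1 g \o c) (b \o idfun).
  exact: factors_through.
apply: factors_bind (fingen_decomp Wfg) => Y e u [Yind [r rK]].
apply: (factors_one (g := b \o e) (u := u)) => //.
have beN : ~ bijective (b \o e).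
  move=> /bij_inv[t [_ tK]]; apply: bN; by exists (e \o t).
have [j Pj] := part_index Yind.
(* For index at least [n] the image lies in the trace; otherwise [Y] occurs in the list [l] and the
   map factors through [beta]. *)
have [nj|nj] := pselect (geq_index n j).
  have [y|h hP] := @lift_inj _ _ _ _ _ _ (b \o e) (@incl_inj _ _ _ Tsub).
    by apply/(inclP Tsub); apply: trace_gen; split=> //; exists j.
  have [w wE] := lin_pair h (\0 : {linear Y -> B}); exists w => y.
  by rewrite /g /= wE /= linear0 addr0 [RHS]hP.
case: j Pj nj => [j|] Pj nj; last by case: nj.
have jn : (j < n)%N by rewrite ltnNge; apply/negP.
have [h hP] := betaP _ _ Yind (lP _ _ jn Pj) beN.
have [w wE] := lin_pair (\0 : {linear Y -> submodule Tsub}) h; exists w => y.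
by rewrite /g /= wE /= linear0 add0r -[RHS]hP.
Qed.

Lemma irreducible_factors n X W (b : {linear W -> X}) :
  P (Some n) X -> fingen W -> ~ split_epi b ->
  factors (fun Y (h : {linear Y -> X}) =>
             indecomposable Y /\ irreducible_morphism h) b.
Proof.
move=> PX; have [E [g gP]] := almost_split PX.
exact: almost_split_factors (part_indecomposable PX) gP.
Qed.

Lemma irreducible_not_bij X Y (h : {linear Y -> X}) :
  irreducible_morphism h -> ~ bijective h.
Proof. by case=> _ hN _ /bij_split_epi. Qed.

Lemma component_closed (C : lmodType A -> Prop) X Y :
  ar_component C -> C X -> ar_link Y X -> C Y.
Proof.
case=> X0 [_ CE] /CE X0X YX; apply/CE.
apply: Relation_Operators.rst_trans X0X _.
by apply: Relation_Operators.rst_sym; apply: Relation_Operators.rst_step.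
Qed.

Lemma component_indecomposable (C : lmodType A -> Prop) X :
  ar_component C -> C X -> indecomposable X.
Proof.
case=> X0 [X0ind CE] /CE X0X.
suff: indecomposable X0 <-> indecomposable X by case=> + _; apply.
elim: X0X {X0ind CE} => [Y Z []|//|Y Z _ []|Y Z W _ [YZ ZY] _ [ZW WZ]] //.
by split=> [/YZ/ZW|/WZ/ZY].
Qed.

(* An indecomposable of finite index admits an irreducible morphism from an
   indecomposable of smaller index, unless it is projective. *)
Lemma regular_index X : in_regular_component X -> P None X.
Proof.
case=> C [[Ccomp Creg] CX].
have [[n|//] PX] := part_index (component_indecomposable Ccomp CX).
have [m] := ubnP n; elim: m n X CX PX => // m IHm n X CX PX nm.
have Xind := part_indecomposable PX; have [Xfg X0 _] := Xind.
have [Xproj _] := Creg X CX.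
have [Z [p [Zfg psurj pN]]] := nonprojective_epi Xfg Xproj.
have Fp := irreducible_factors PX Zfg pN.
(* By induction no irreducible map to [X] starts at an index below [n], so the surjection [p] would
   make the trace of the tail all of [X]. *)
exfalso; apply: (tail_trace_proper PX) => x; have [z <-] := psurj x.
apply: factors_trace; apply: factors_sub Fp => Y h [Yind hirr].
split; last exact: irreducible_not_bij.
have CY : C Y by apply: component_closed Ccomp CX _; split=> //; right; exists h.
have [j Pj] := part_index Yind; exists j; split=> //.
case: j Pj => //= j Pj; rewrite leqNgt; apply/negP => jn.
have PY : P None Y by apply: (IHm j) => //; apply: leq_trans jn _.
by have := part_unique Pj PY.
Qed.

(** * Maps into a pi-component *)

Section PiComponent.
Variable C : lmodType A -> Prop.
Hypotheses (Ccomp : ar_component C)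
  (Cpost : forall X, C X -> postprojective_module P X).

(** [X] is a summand of a sum of modules of finite index, hence by locality isomorphic to one of
    them. *)
Lemma component_index X : C X -> exists n, P (Some n) X.
Proof.
move=> CX; have Xind := component_indecomposable Ccomp CX.
have [s [M' [Ds [f fb]]]] := Cpost CX; have [f' [fK f'K]] := bij_inv fb.
have [i iE] := @lin_pair _ _ X X M' idfun \0.
have Fs := direct_sum_factors (fst \o f) Ds.
have [||Y [g [[n PY] gb]]] := factors_bij Xind _ (factors_pre (f' \o i) Fs).
- by move=> Y _ [n /part_indecomposable].
- by exists idfun => x; rewrite /= f'K iE.
by exists n; apply: part_iso PY; exists g.
Qed.

Lemma kdim_bounded (l : seq (lmodType A)) : exists b, forall Y,
  fingen Y -> List.Exists (isomorphic Y) l -> (kdim Y <= b)%N.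
Proof.
elim: l => [|L l [b bP]]; first by exists 0%N => Y _ Yl; inversion Yl.
exists (maxn (kdim L) b) => Y Yfg Yl; rewrite leq_max; apply/orP.
inversion Yl as [L' l' YL|L' l' Yl']; last by right; apply: bP.
by left; rewrite (iso_kdim YL).
Qed.

Lemma tail_antitone m n X : (m <= n)%N -> tail n X -> tail m X.
Proof.
move=> mn [i [ni Pi]]; exists i; split=> //.
by case: i ni {Pi} => //= k; apply: leq_trans.
Qed.

(** A map from [V] to a module of finite index is no split epimorphism, so it factors through
    irreducible maps. Iterating, the terms that stay below index [m] become long radical composites
    of bounded dimension and vanish. *)
Lemma infinite_index_factors m V X (v : {linear V -> X}) : P None V -> C X ->
  factors (fun Y (_ : {linear Y -> X}) => C Y /\ tail m Y) v.
Proof.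
move=> PV CX; have [Vfg _ _] := part_indecomposable PV.
have [l lP] := finite_below m; have [b bP] := kdim_bounded l.
pose low Y := exists j, (j < m)%N /\ P (Some j) Y.
have tail_or_low Y : indecomposable Y -> tail m Y \/ low Y.
  move=> /part_index[[j|] Pj]; last by left; exists None.
  by have [mj|jm] := leqP m j; [left; exists (Some j) | right; exists j].
have low_dim Y : low Y -> (kdim Y <= b)%N.
  by move=> [j [jm Pj]]; apply: bP (lP _ _ jm Pj); have [] := part_indecomposable Pj.
have [Xm|Xlow] := tail_or_low X (component_indecomposable Ccomp CX).
  exact: (factors_one (g := idfun) (u := v)).
pose F k Z := fun Y (g : {linear Y -> Z}) =>
  C Y /\ (tail m Y \/ (low Y /\ radpow b k g)).
have F0 Z (w : {linear V -> Z}) : C Z -> low Z -> factors (F 0%N Z) w.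
  move=> CZ Zlow; have [j [_ PZ]] := Zlow; have Zind := part_indecomposable PZ.
  have wN : ~ split_epi w.
    have [_ Z0 _] := Zind => /(split_epi_bij (part_indecomposable PV) Z0) wb.
    by have := bij_index wb PV PZ.
  apply: factors_sub (irreducible_factors PZ Vfg wN) => Y h [Yind hirr].
  split; first by apply: component_closed Ccomp CZ _; split=> //; right; exists h.
  have [Ym|Ylow] := tail_or_low Y Yind; [by left | right; split=> //].
  by split; rewrite ?low_dim //; apply: irreducible_not_bij.
have FS k : factors (F k X) v.
  elim: k => [|k IHk]; first exact: F0.
  apply: factors_bind_id IHk => Y g u [CY [Ym|[Ylow radg]]].
    by apply: (factors_one (g := g) (u := u)) => //; split=> //; left.
  apply: factors_bind (F0 Y u CY Ylow) => Z w u' [CZ Zm].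
  apply: (factors_one (g := g \o w) (u := u')) => //; split=> //.
  by case: Zm => [Zm|[Zlow radw]]; [left | right; split=> //; exists Y, w, g].
have [k kP] := @harada_sai K A b.
apply: factors_bind_id (FS k) => Y g u [CY [Ym|[_ /kP g0]]].
  exact: (factors_one (g := g) (u := u)).
by apply: factors0 => x; rewrite /= g0.
Qed.

(* The traces in [X] of the modules of [C] of index at least [m] decrease with
   [m]; their limit is generated by modules of arbitrarily large index, so its
   indecomposable summands have infinite index.  The inclusion of such a summand
   factors through modules of [C] whose images lie in the limit, so the summand
   would be isomorphic to a member of [C]. *)
Lemma hom_infinite_index V X (v : {linear V -> X}) x : P None V -> C X -> v x = 0.
Proof.
move=> PV CX; have Xind := component_indecomposable Ccomp CX.
have [Xfg _ _] := Xind.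
pose G m Z := fun Y (_ : {linear Y -> Z}) => C Y /\ tail m Y.
pose Tsub m := trace_submodule (G m X).
(* [m0] minimizes the dimension of the trace, so the decreasing chain is constant from [m0] on. *)
have [m0 m0P] : exists m0, forall m,
    (kdim (submodule (Tsub m0)) <= kdim (submodule (Tsub m)))%N.
  pose Q n := `[< exists m, kdim (submodule (Tsub m)) = n >].
  have exQ : exists n, Q n.
    by exists (kdim (submodule (Tsub 0%N))); apply/asboolP; exists 0%N.
  case: (ex_minnP exQ) => n /asboolP[m0 <-] nmin.
  by exists m0 => m; apply: nmin; apply/asboolP; exists m.
have T_antitone m n z : (m <= n)%N -> trace (G n X) z -> trace (G m X) z.
  move=> mn; apply: trace_bind => Y g y [CY Yn]; apply: trace_gen.
  by split=> //; apply: tail_antitone Yn.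
have T_stable m z : (m0 <= m)%N -> trace (G m0 X) z -> trace (G m X) z.
  move=> m0m /(inclP (Tsub m0))[u <-].
  have [w|j jP] := @lift_inj _ _ _ _ _ _ (incl (Tsub m)) (@incl_inj _ _ _ (Tsub m0)).
    by apply/(inclP (Tsub m0)); apply: (T_antitone _ m) => //;
       apply/(inclP (Tsub m)); exists w.
  have jinj : injective j.
    by move=> w w' ww'; apply: (@incl_inj _ _ _ (Tsub m)); rewrite -!jP ww'.
  have [R0fg _ _] := kdim_inj (@incl_inj _ _ _ (Tsub m0)) Xfg.
  have [_ _ /(_ (m0P m)) jb] := kdim_inj jinj R0fg.
  have [w <-] := bij_surj jb u; rewrite jP.
  by apply/(inclP (Tsub m)); exists w.
pose R := submodule (Tsub m0); pose rho : {linear R -> X} := incl (Tsub m0).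
have rho_inj : injective rho by apply: incl_inj.
have [Rfg _ _] := kdim_inj rho_inj Xfg.
(* Images of members of [C] of index at least [m0] lie in [R], so whole factorizations lift to
   [R]. *)
have lift m Z (w : {linear Z -> X}) : (m0 <= m)%N -> factors (G m X) w ->
    exists w' : {linear Z -> R}, w =1 rho \o w' /\ factors (G m R) w'.
  move=> m0m; apply: factors_lift => Y g [CY Ym].
  have [y|h hP] := @lift_inj _ _ _ _ _ _ g rho_inj.
    by apply/(inclP (Tsub m0)); apply: (T_antitone _ m) => //; apply: trace_gen.
  by exists h; split=> // y; rewrite /= hP.
have R_trace m r : (m0 <= m)%N -> trace (G m R) r.
  move=> m0m; have : trace (G m X) (rho r).
    by apply: T_stable => //; apply/(inclP (Tsub m0)); exists r.
  case=> Z [w [z [Fw wz]]]; have [w' [wE Fw']] := lift m Z w m0m Fw.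
  suff -> : r = w' z by apply: factors_trace.
  by apply: rho_inj; rewrite -wz wE.
apply: contrapT => vx0.
have [r rP] : exists r, rho r = v x.
  apply/(inclP (Tsub m0)); apply: factors_trace.
  exact: infinite_index_factors.
have r0 : (idfun : {linear R -> R}) r <> 0.
  by move=> /= r0; apply: vx0; rewrite -rP r0 linear0.
have [Y [i [Yind [p pK]]]] := factors_nonzero (fingen_decomp Rfg) r0.
have PY : P None Y.
  have [[n|//] PY] := part_index Yind; exfalso.
  apply: (tail_trace_proper PY) => y; rewrite -[y]pK.
  (* Index at least [m0] makes the traces available in [R]; index above [n] excludes isomorphisms
     onto [Y]. *)
  apply: trace_map (R_trace (maxn m0 n.+1) (i y) (leq_maxl _ _)) => Z h z [CZ Zm].
  apply: (trace_gen (g := p \o h)); split.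
    by apply: tail_antitone Zm; rewrite leq_max leqnSn orbT.
  case: Zm => j [jm Pj] /bij_index/(_ Pj PY) jn.
  by move: jm; rewrite jn /= geq_max ltnn andbF.
(* The inclusion of [Y] in [X] factors through members of [C] inside [R]; projecting to [Y] gives
   the identity, so by locality [Y] is isomorphic to a member of [C], which has finite index. *)
have [i' [iE Fi']] := lift m0 Y (rho \o i) (leqnn _)
  (infinite_index_factors m0 (rho \o i) PY CX).
have Fpi : factors (fun Z (_ : {linear Z -> Y}) => C Z) (p \o i').
  apply: factors_bind Fi' => Z h u [CZ _].
  exact: (factors_one (g := p \o h) (u := u)).
have [||Z [h [CZ hb]]] := factors_bij Yind _ Fpi.
- by move=> Z _; apply: component_indecomposable.
- exists idfun => y /=; rewrite -[RHS]pK; congr (p _);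
  by apply: rho_inj; rewrite -[RHS]/((rho \o i) y) iE.
have [n PZ] := component_index CZ.
by have := bij_index hb PZ PY.
Qed.

End PiComponent.
End Partition.

(** * Irreducible monomorphisms and their cokernels *)

Section Irreducible.
Variables (K : fieldType) (A : falgType K).
Implicit Types M N Q U X Y Z : lmodType A.

(** Pulling [q] back along [i] gives an extension of [U] by [M] through which [f] factors.
    Irreducibility splits this extension, and the section yields the lift. *)
Lemma irreducible_mono_lift M N Q U (f : {linear M -> N}) (q : {linear N -> Q})
    (i : {linear U -> Q}) :
  fingen N -> fingen U -> irreducible_morphism f -> injective f ->
  is_cokernel f q -> ~ surjective i ->
  exists t : {linear U -> N}, q \o t =1 i.
Proof.
move=> Nfg Ufg [_ _ firr] finj [qsurj qker] isurj.
have [Z [a [b [qa abP ab0 Zfg]]]] := pullback q i.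
have [w wE] := lin_pair a b.
have winj : injective w.
  by apply: ker0_inj => z; rewrite wE => -[az bz]; apply: ab0.
(* The pair [(f m, 0)] lies in the pullback because [q] vanishes on the image of [f]. *)
have [fz fzE] := @lin_pair _ _ M N U f \0.
have [m|g gP] := @lift_inj _ _ _ _ _ _ fz winj.
  have [|z [az bz]] := abP (f m) 0.
    by rewrite linear0; apply/qker; exists m.
  by exists z; rewrite wE fzE az bz.
have ag m : a (g m) = f m by have := gP m; rewrite wE fzE => -[].
have bg m : b (g m) = 0 by have := gP m; rewrite wE fzE => -[].
have [|[r rK]|[s sK]] := firr Z (Zfg Nfg Ufg) g a; first by move=> m; rewrite ag.
  have ker_b z : b z = 0 -> z = g (r z).
    move=> bz; have /qker[m fm] : q (a z) = 0 by rewrite qa bz linear0.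
    suff -> : z = g m by rewrite rK.
    by apply: winj; rewrite !wE bz ag bg fm.
  (* The kernel of [r] is a complement of the image of [g], and [b] maps it isomorphically onto
     [U]. *)
  pose k := incl (ker_submodule r).
  have rk y : r (k y) = 0 by apply/(inclP (ker_submodule r)); exists y.
  have bk : bijective (b \o k).
    apply: inj_surj_bij.
      apply: ker0_inj => y /ker_b; rewrite rk linear0 => ky.
      by apply: (@incl_inj _ _ _ (ker_submodule r)); rewrite linear0.
    move=> u; have [n nu] := qsurj (i u); have [z [_ bz]] := abP n u nu.
    have [y yE] : exists y, k y = z - g (r z).
      by apply/(inclP (ker_submodule r)); rewrite linearB rK subrr.
    by exists y; rewrite /= yE linearB bg subr0.
  have [j [_ jK]] := bij_inv bk.
  by exists (a \o k \o j) => u; rewrite /= qa -[b _]/((b \o k) (j u)) jK.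
(* A section [s] of [a] gives [q] as [i \o b \o s], so [i] would be surjective. *)
by case: isurj => y; have [n <-] := qsurj y; exists (b (s n)); rewrite -qa sK.
Qed.

End Irreducible.

Theorem corollary3p5 (K : closedFieldType) (A : falgType K)
  (A_basic : basic_algebra A)
  (C : lmodType A -> Prop) (C_pi : pi_component C)
  (M N : lmodType A) (M_in_C : C M) (N_in_C : C N)
  (f : {linear M -> N})
  (f_irr : irreducible_morphism f) (f_mono : injective f)
  (Q : lmodType A) (q : {linear N -> Q}) (q_coker : is_cokernel f q)
  (Q_reg : in_regular_component Q) :
  simple_regular Q.
Proof.
have [Ccomp [P [HP Cpost]]] := C_pi.
have Qind : indecomposable Q.
  by have [D [[Dcomp _] DQ]] := Q_reg; apply: component_indecomposable Dcomp DQ.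
split=> //.
  by exists [:: Q]; split; [constructor | exact: iso_prod0].
move=> U i iinj [s [s_reg [e eb]]] [[u u0] isurj].
have [Nfg _ _] := component_indecomposable Ccomp N_in_C.
have [Qfg _ _] := Qind; have [Ufg _ _] := kdim_inj iinj Qfg.
have [t tE] := irreducible_mono_lift Nfg Ufg f_irr f_mono q_coker isurj.
have [e' [eK _]] := bij_inv eb.
(* As [q \o t] agrees with the injective [i], it is enough that [t] vanishes: the summands of [U]
   have infinite index, while [N] lies in [C]. *)
suff tu : t u = 0 by apply/u0/iinj; rewrite -tE /= tu !linear0.
have /(factors_trace (e u)) := direct_sum_factors (t \o e') s_reg.
rewrite /= eK; apply: (@trace_min _ _ _ _ (fun y => y = 0)).
  by split=> // a x y -> ->; rewrite scaler0 addr0.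
by move=> Y g y /(regular_index HP) PY; apply: (hom_infinite_index HP Ccomp Cpost).
Qed.
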